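(* Let $\mu\in[0,\tfrac12]$ and let $c<H(L_{1/2})=-\tfrac32\sqrt[3]{\lambda_2}$, where $H$ is the Hamiltonian of the Hill four-body system with parameter $\mu$. Let $\widetilde\Sigma_c^b\subset T^*S^3$ be the Moser regularization of the bounded component $\Sigma_c^b$ of the energy level set $H^{-1}(c)$, and let $\widetilde\Sigma_c^b|_{\mathrm{Fix}(\sigma)}\subset T^*S^2$ be its planar counterpart (all defined in the context). Then $$\widetilde\Sigma_c^b\cong (S^*S^3,\xi_{st})\qquad\text{and}\qquad \widetilde\Sigma_c^b|_{\mathrm{Fix}(\sigma)}\cong (S^*S^2,\xi_{st}).$$ Here $\cong$ means the following: the canonical Liouville one-form of $T^*S^3$ (respectively $T^*S^2$) restricts to a contact form on the compact 5-dimensional manifold $\widetilde\Sigma_c^b$ (respectively on the compact 3-dimensional manifold $\widetilde\Sigma_c^b|_{\mathrm{Fix}(\sigma)}$), and the resulting contact manifold is contactomorphic to the unit cotangent bundle $S^*S^3$ (respectively $S^*S^2$) with its standard contact structure $\xi_{st}$.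
   Context: Parameters. For $\mu\in[0,\tfrac12]$ put $d=\sqrt{1-3\mu+3\mu^2}$, $\lambda_1=\tfrac32(1-d)$, $\lambda_2=\tfrac32(1+d)$, $a=\tfrac12(1-\lambda_2)$, $b=\tfrac12(1-\lambda_1)$. Hamiltonian. On $T^*(\mathbb{R}^3\setminus\{0\})=(\mathbb{R}^3\setminus\{0\})\times\mathbb{R}^3$ with symplectic form $\omega=dp_x\wedge dx+dp_y\wedge dy+dp_z\wedge dz$, let $$H(x,y,z,p_x,p_y,p_z)=\tfrac12(p_x^2+p_y^2+p_z^2)+p_xy-p_yx-\frac{1}{\sqrt{x^2+y^2+z^2}}+ax^2+by^2+\tfrac12z^2 .$$ Equivalently $H=\tfrac12\big((p_x+y)^2+(p_y-x)^2+p_z^2\big)+U(x,y,z)$ with effective potential $U(x,y,z)=-\frac{1}{\sqrt{x^2+y^2+z^2}}-\tfrac12(\lambda_2x^2+\lambda_1y^2-z^2)$. First critical value. The points $L_1=(\lambda_2^{-1/3},0,0)$, $L_2=(-\lambda_2^{-1/3},0,0)$ are critical points of $U$; a critical point $(x,y,0)$ of $U$ corresponds to the critical point $(x,y,0,-y,x,0)$ of $H$. The common value of $H$ at the critical points corresponding to $L_1,L_2$ is denoted $H(L_{1/2})=-\tfrac32\sqrt[3]{\lambda_2}$; it is the lowest critical value. Bounded component. Let $\pi(x,y,z,p_x,p_y,p_z)=(x,y,z)$, $\Sigma_c=H^{-1}(c)$, and let the Hill's region be $\mathscr K_c=\pi(\Sigma_c)=\{q\in\mathbb{R}^3\setminus\{0\}: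 U(q)\le c\}$. For $c<H(L_{1/2})$, $\mathscr K_c^b$ denotes the bounded connected component of $\mathscr K_c$ (the one whose closure contains the origin), and $\Sigma_c^b=\pi^{-1}(\mathscr K_c^b)\cap\Sigma_c$. It is non-compact because of collisions at the origin. Moser regularization. Write $S^3=\{\xi\in\mathbb{R}^4:|\xi|=1\}$ with $\xi=(\xi_0,\xi_1,\xi_2,\xi_3)$, and identify $T^*S^3\cong TS^3=\{(\xi,\eta)\in\mathbb{R}^4\times\mathbb{R}^4: |\xi|=1,\ \langle\xi,\eta\rangle=0\}$ via the standard metric; the canonical Liouville one-form is $\lambda_{can}=\sum_{i=0}^3\eta_i\,d\xi_i$ restricted to this set. The stereographic projection from the north pole $N=(1,0,0,0)$ induces a symplectomorphism $T^*\mathbb{R}^3\to T^*(S^3\setminus\{N\})$, $(\mathbf X,\mathbf P)\mapsto(\xi,\eta)$, where for $k=1,2,3$ $$\xi_0=\frac{|\mathbf X|^2-1}{|\mathbf X|^2+1},\quad \xi_k=\frac{2\mathbf X_k}{|\mathbf X|^2+1},\quad \eta_0=\langle\mathbf X,\mathbf P\rangle,\quad \eta_k=\frac{|\mathbf X|^2+1}{2}\mathbf P_k-\langle\mathbf X,\mathbf P\rangle\mathbf X_k .$$ Let $\Psi$ be the composition of the symplectic switch map $(\mathbf X,\mathbf P)\mapsto(-\mathbf P,\mathbf X)$ (where $\mathbf X=(x,y,z)$ is the position and $\mathbf P=(p_x,p_y,p_z)$ the momentum) followed by this symplectomorphism. Under $\Psi$, collisions (position tending to $0$, momentum tending to infinity)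 correspond to the fibre over $N$. The Moser-regularized energy level set $\widetilde\Sigma_c^b\subset T^*S^3$ is the compactification of $\Psi(\Sigma_c^b)$ obtained by adding the limit points in the fibre over $N$, i.e. the closure of $\Psi(\Sigma_c^b)$ in $T^*S^3$. Equivalently, it is the corresponding component of $Q^{-1}(\tfrac12)$, where $$Q(\xi,\eta)=\tfrac12|\eta|^2f(\xi,\eta)^2,$$ $$f=1+(\eta_1\xi_2-\eta_2\xi_1)(1-\xi_0)+(ag_1^2+bg_2^2+\tfrac12g_3^2)(1-\xi_0)-(c+\tfrac12)(1-\xi_0),\qquad g_k=\eta_k(1-\xi_0)+\xi_k\eta_0 .$$ Planar problem. The symplectic involution $\sigma(x,y,z,p_x,p_y,p_z)=(x,y,-z,p_x,p_y,-p_z)$ preserves $H$, and $\mathrm{Fix}(\sigma)=\{z=p_z=0\}$ is the planar problem. Restricting the whole procedure to $\mathrm{Fix}(\sigma)$ gives $\widetilde\Sigma_c^b|_{\mathrm{Fix}(\sigma)}=\widetilde\Sigma_c^b\cap\{\xi_3=\eta_3=0\}$, regarded as a subset of $T^*S^2$ where $S^2=S^3\cap\{\xi_3=0\}$. Standard contact structure. For a hypersurface $\Sigma\subset T^*Q_0$ transverse to the natural Liouville vector field $\sum_i p_i\partial_{p_i}$ (the radial field in fibre direction), the standard contact structure is $\xi_{st}=\ker(\lambda_{can}|_\Sigma)$, with $\lambda_{can}=\sum_i p_i\,dq_i$. In particular this defines $\xi_{st}$ on the unit cotangent bundle $S^*S^n\subset T^*S^n$ (round metric). *)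

(* Defs.v *)
From HB Require Import structures.
From mathcomp Require Import all_boot all_order all_fingroup all_algebra.
From mathcomp Require Import all_classical all_reals all_analysis.
From mathcomp Require Import ring.

Set Implicit Arguments.
Unset Strict Implicit.
Unset Printing Implicit Defensive.

Import Order.TTheory GRing.Theory Num.Theory.
Import numFieldNormedType.Exports.

Local Open Scope classical_set_scope.
Local Open Scope ring_scope.

(******************************************************************************)
(* Smooth maps, embedded submanifolds of a normed space, and contact forms.   *)
(* Only finite-dimensional spaces are used, where (Frechet) differentiability *)
(* together with C^k directional derivatives is the usual notion of C^(k+1).  *)
(******************************************************************************)

Section Smooth.
Context {R : realType}.

Fixpoint Ck_open {V W : normedModType R} (k : nat) (U : set V) (f : V -> W) :
    Prop :=
  match k with
  | 0 => forall x, U x -> {for x, continuous f}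
  | k'.+1 => (forall x, U x -> differentiable f x) /\
             (forall v : V, Ck_open k' U (fun x => 'd f x v))
  end.

Definition smooth_open {V W : normedModType R} (U : set V) (f : V -> W) : Prop :=
  forall k, Ck_open k U f.

Definition smooth_extension {V W : normedModType R} (A : set V) (f : V -> W)
    (x : V) (U : set V) (F : V -> W) : Prop :=
  [/\ open U, U x, smooth_open U F & forall y, A y -> U y -> F y = f y].

(* Smoothness on an arbitrary subset: f extends smoothly around each point.   *)
Definition smooth_on {V W : normedModType R} (A : set V) (f : V -> W) : Prop :=
  forall x, A x -> exists U F, smooth_extension A f x U F.

Definition diffeo {V W : normedModType R} (A : set V) (B : set W)
    (f : V -> W) (g : W -> V) : Prop :=
  [/\ (forall x, A x -> B (f x)) /\ (forall y, B y -> A (g y)),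
      forall x, A x -> g (f x) = x,
      forall y, B y -> f (g y) = y,
      smooth_on A f
    & smooth_on B g].

Definition submanifold {V : normedModType R} (k : nat) (M : set V) : Prop :=
  forall x, M x -> exists (U : set V) (O : set 'rV[R]_k) phi psi,
    [/\ open U, U x, open O & diffeo O (M `&` U) phi psi].

(* The tangent space of M at x, as the set of velocities at time 0 of smooth  *)
(* curves in M through x.                                                     *)
Definition tangent {V : normedModType R} (M : set V) (x v : V) : Prop :=
  exists (I : set R^o) (gamma : R^o -> V),
    [/\ open I, I 0, smooth_open I gamma, (forall t, I t -> M (gamma t))
      & gamma 0 = x /\ 'd gamma 0 1 = v].

End Smooth.

Section Contact.
Context {R : realType}.

(* A one-form is given as a function alpha of the base point and the vector.  *)
Definition one_form {V : normedModType R} (alpha : V -> V -> R^o) : Prop :=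
  (forall x, linear (alpha x)) /\
  (forall v, smooth_open setT (fun x => alpha x v)).

Definition ext_deriv {V : normedModType R} (alpha : V -> V -> R^o) (x u v : V) :
    R :=
  'd (fun y => alpha y v) x u - 'd (fun y => alpha y u) x v.

(* The value of alpha /\ (d alpha)^n on (v_0, ..., v_2n), up to a positive    *)
(* constant depending only on n and on the normalization of wedge products.   *)
Definition contact_volume {V : normedModType R} (n : nat)
    (alpha : V -> V -> R^o) (x : V) (v : 'I_(n.*2).+1 -> V) : R :=
  \sum_(s : 'S_(n.*2).+1) (-1) ^+ s * alpha x (v (s ord0)) *
    \prod_(i < n) ext_deriv alpha x (v (s (inord (i.*2).+1)))
                                    (v (s (inord (i.*2).+2))).

(* The restriction of alpha to the (2n+1)-dimensional submanifold M is a      *)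
(* contact form: alpha /\ (d alpha)^n vanishes at no point of M as a form on  *)
(* the tangent space of M.                                                    *)
Definition contact_form {V : normedModType R} (n : nat) (M : set V)
    (alpha : V -> V -> R^o) : Prop :=
  [/\ submanifold (n.*2).+1 M, one_form alpha
    & forall x, M x -> exists v : 'I_(n.*2).+1 -> V,
        (forall i, tangent M x (v i)) /\ contact_volume alpha x v != 0].

Definition contact_plane {V : normedModType R} (M : set V)
    (alpha : V -> V -> R^o) (x : V) : set V :=
  [set v | tangent M x v /\ alpha x v = 0].

(* The differential of f : M -> N at x is computed with an arbitrary smooth   *)
(* extension F of f around x; its values on tangent vectors of M do not       *)
(* depend on F.                                                               *)
Definition contactomorphic {V W : normedModType R}
    (M : set V) (alpha : V -> V -> R^o) (N : set W) (beta : W -> W -> R^o) :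
    Prop :=
  exists f g, diffeo M N f g /\
    forall x U F, M x -> smooth_extension M f x U F ->
      'd F x @` contact_plane M alpha x = contact_plane N beta (f x).

End Contact.

(******************************************************************************)
(* The cotangent bundle T^*S^n, realized as TS^n inside R^(n+1) x R^(n+1).    *)
(******************************************************************************)

Section Sphere.
Context {R : realType}.

(* The norm `|_| of the library on 'rV[R]_n is the sup norm, hence this. *)
Definition dot {n} (u v : 'rV[R]_n) : R := \sum_(i < n) u 0 i * v 0 i.

Definition enorm {n} (u : 'rV[R]_n) : R := Num.sqrt (dot u u).

Definition cotangent_sphere n : set ('rV[R]_n.+1 * 'rV[R]_n.+1) :=
  [set w | enorm w.1 = 1 /\ dot w.1 w.2 = 0].

Definition unit_cotangent_sphere n : set ('rV[R]_n.+1 * 'rV[R]_n.+1) :=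
  [set w | cotangent_sphere w /\ enorm w.2 = 1].

(* sum_i eta_i d xi_i at the point w = (xi, eta) *)
Definition lambda_can {n} (w v : 'rV[R]_n.+1 * 'rV[R]_n.+1) : R^o :=
  dot w.2 v.1.

End Sphere.

(******************************************************************************)
(* The Hill four-body problem and its Moser regularization.                   *)
(******************************************************************************)

Section HillFourBody.
Context {R : realType}.
Implicit Types mu c : R.

Definition hill_d mu : R := Num.sqrt (1 - 3 * mu + 3 * mu ^+ 2).
Definition lambda1 mu : R := 3 / 2 * (1 - hill_d mu).
Definition lambda2 mu : R := 3 / 2 * (1 + hill_d mu).
Definition hill_a mu : R := (1 - lambda2 mu) / 2.
Definition hill_b mu : R := (1 - lambda1 mu) / 2.

(* w = (q, p) with q = (x, y, z) the position, p the momentum; the domain of  *)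
(* hill_H is q != 0.                                                          *)
Definition hill_H mu (w : 'rV[R]_3 * 'rV[R]_3) : R :=
  let: (q, p) := w in
  let x := q 0 0 in let y := q 0 1 in let z := q 0 2 in
  let px := p 0 0 in let py := p 0 1 in let pz := p 0 2 in
  (px ^+ 2 + py ^+ 2 + pz ^+ 2) / 2 + px * y - py * x
  - (Num.sqrt (x ^+ 2 + y ^+ 2 + z ^+ 2))^-1
  + hill_a mu * x ^+ 2 + hill_b mu * y ^+ 2 + z ^+ 2 / 2.

Definition vec3 (x y z : R) : 'rV[R]_3 := \row_(i < 3) [:: x; y; z]`_i.

(* The critical point of hill_H over L_1; the one over L_2 is its opposite    *)
(* and has the same energy.                                                   *)
Definition crit_L1 mu : 'rV[R]_3 * 'rV[R]_3 :=
  let l := lambda2 mu `^ (- 3^-1) in (vec3 l 0 0, vec3 0 l 0).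

Definition energy_set mu c : set ('rV[R]_3 * 'rV[R]_3) :=
  [set w | w.1 != 0 /\ hill_H mu w = c].

Definition hill_region mu c : set 'rV[R]_3 := fst @` energy_set mu c.

(* The bounded connected component of the Hill's region, whose closure        *)
(* contains the origin.                                                       *)
Definition bounded_hill_region mu c : set 'rV[R]_3 :=
  [set q | let C := connected_component (hill_region mu c) q in
           [/\ hill_region mu c q, bounded_set C & closure C 0]].

Definition bounded_energy_set mu c : set ('rV[R]_3 * 'rV[R]_3) :=
  fst @^-1` bounded_hill_region mu c `&` energy_set mu c.

(* T^*R^n -> T^*S^n induced by the stereographic projection from the north    *)
(* pole (1, 0, ..., 0); 'rV_n.+1 is 'rV_(1 + n), with xi_0 as the first block.*)
Definition stereo {n} (w : 'rV[R]_n * 'rV[R]_n) : 'rV[R]_n.+1 * 'rV[R]_n.+1 :=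
  let: (X, P) := w in
  let s := dot X X in
  (row_mx (const_mx ((s - 1) / (s + 1)) : 'rV_1) ((2 / (s + 1)) *: X),
   row_mx (const_mx (dot X P) : 'rV_1) (((s + 1) / 2) *: P - dot X P *: X)).

Definition switch {n} (w : 'rV[R]_n * 'rV[R]_n) : 'rV[R]_n * 'rV[R]_n :=
  (- w.2, w.1).

Definition moser_Psi (w : 'rV[R]_3 * 'rV[R]_3) : 'rV[R]_4 * 'rV[R]_4 :=
  stereo (switch w).

(* T^*S^3 is closed in R^4 x R^4, so this is also the closure in T^*S^3. *)
Definition regularized mu c : set ('rV[R]_4 * 'rV[R]_4) :=
  closure (moser_Psi @` bounded_energy_set mu c).

(* The inclusion of T^*S^2 in T^*S^3 as {xi_3 = eta_3 = 0}. *)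
Definition planar_incl (w : 'rV[R]_3 * 'rV[R]_3) : 'rV[R]_4 * 'rV[R]_4 :=
  (row_mx w.1 (0 : 'rV_1), row_mx w.2 (0 : 'rV_1)).

Definition regularized_planar mu c : set ('rV[R]_3 * 'rV[R]_3) :=
  planar_incl @^-1` regularized mu c.

Lemma crit_L1_energy mu :
  hill_H mu (crit_L1 mu) = - (3 / 2) * lambda2 mu `^ 3^-1.
Proof.
have l2_gt0 : 0 < lambda2 mu.
  by rewrite mulr_gt0 ?divr_gt0// ltr_wpDr ?sqrtr_ge0.
rewrite /hill_H /crit_L1 /vec3 !mxE /= powRN.
set l := lambda2 mu `^ 3^-1.
have l_gt0 : 0 < l by rewrite powR_gt0.
have l3 : lambda2 mu = l ^+ 3.
  by rewrite -powR_mulrn ?ltW// -powRrM mulVf ?pnatr_eq0// powRr1 ?ltW.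
rewrite expr0n /= !addr0 sqrtr_sqr gtr0_norm ?invr_gt0// invrK /hill_a l3.
by field; rewrite gt_eqF.
Qed.

End HillFourBody.

(* Main.v *)
(* For fixed momentum p and direction u, the level H = c meets the ray r u,
   0 < r, inside the bounded component of Hill's region in exactly one point,
   transversally: there the radial derivative of H is positive, because
   (q . grad U)^2 > 2 (x^2 + y^2) (c - U) whenever |q| < lambda2^(-1/3). After
   Moser regularization, p and u become the base point and the direction of a
   covector, so the regularized level is the graph {(xi, rho(xi, v) v)} of a
   function rho on the unit cotangent bundle; on each fibre rho is a simple root
   of a cubic with smooth coefficients, including over the collision fibre,
   hence rho is smooth. The radial projection (xi, eta) |-> (xi, eta / |eta|)
   of such a graph multiplies the Liouville form by a positive function, hence
   it is a contactomorphism. *)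

Require Import Defs.
From HB Require Import structures.
From mathcomp Require Import all_boot all_order all_fingroup all_algebra.
From mathcomp Require Import all_classical all_reals all_analysis.
From mathcomp Require Import ring lra zify.

Set Implicit Arguments.
Unset Strict Implicit.
Unset Printing Implicit Defensive.

Import Order.TTheory GRing.Theory Num.Theory.
Import numFieldNormedType.Exports.

Local Open Scope classical_set_scope.
Local Open Scope ring_scope.

(** * Smooth maps *)

Section Calculus.
Context {R : realType}.
Implicit Types V W Z : normedModType R.

(** The collision fibre is the obstacle: over the pole N the momentum is infinite and H is singular,
    while |eta| f = 1 stays polynomial. As f is quadratic in eta, on the ray of a unit covector this
    equation is a cubic al r + be r^2 + ga r^3 = 1, which over N is just r = 1. Off N its left side
    minus 1 equals |q| (H - c), so every estimate on H passes to the cubic. The cubic may have other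
    roots, outside the bounded component; the right one is selected by |q| < lambda2^(-1/3), written
    r (1 - xi_0) l < 1 so that it keeps a meaning over N. Energies below -(3/2) lambda2^(1/3)
    exclude the whole sphere |q| = lambda2^(-1/3) from Hill's region, which makes this selection
    stable. Smoothness of the root comes from elementary means: subtracting the equations of two
    nearby roots produces a divided difference, whence continuity, then a formula for the
    differential that contains the root itself and bootstraps to all orders. For the closure, the
    graph is compact, hence closed, and geodesics through N show that its points over N are
    limits. *)

Lemma near_eq_is_diff V W (f g : V -> W) x :
  differentiable f x -> (\near x, f x = g x) -> is_diff x g ('d f x).
Proof.
move=> df fg.
have loc : continuous ('d f x) /\
    g \o shift x = cst (g x) + 'd f x +o_ 0 id.
  split; first exact: diff_continuous.
  have fgx : f x = g x by exact: nbhs_singleton fg.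
  have /eqaddoP fo := diff_locally df.
  have fg0 : \forall y \near (0 : V), f (y + x) = g (y + x).
    by move: fg; rewrite (near_shift 0) subr0.
  apply/eqaddoP => e e0; near=> y.
  rewrite !fctE /= -fgx -(near fg0 y) //.
  by near: y; have := fo e e0; apply: filterS => y.
split; last exact: (diff_unique loc.1 loc.2).
by apply/diff_locallyP; rewrite (diff_unique loc.1 loc.2).
Unshelve. all: by end_near. Qed.

Lemma open_eq_is_diff V W (U : set V) (f g : V -> W) x :
  open U -> U x -> (forall y, U y -> f y = g y) ->
  differentiable f x -> is_diff x g ('d f x).
Proof.
move=> oU Ux fg df; apply: near_eq_is_diff => //.
by apply: filterS fg _; exact: open_nbhs_nbhs.
Qed.

Section OpenSet.
Context {V : normedModType R} (U : set V) (oU : open U).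
Implicit Types Y : normedModType R.

Lemma Ck_open_ext W k (f g : V -> W) :
  (forall x, U x -> f x = g x) -> Ck_open k U f -> Ck_open k U g.
Proof using oU.
elim: k f g => [|k IH] f g fg /=.
  move=> cf x Ux; change (g @ x --> g x); rewrite -(fg x Ux).
  apply: cvg_trans (cf x Ux); apply: near_eq_cvg.
  by apply: filterS fg _; exact: open_nbhs_nbhs.
move=> [df cdf]; split=> [x Ux|v].
  by have [] := open_eq_is_diff oU Ux fg (df x Ux).
apply: IH (cdf v) => x Ux.
by have [_ ->] := open_eq_is_diff oU Ux fg (df x Ux).
Qed.

Lemma Ck_openS W k (f : V -> W) : Ck_open k.+1 U f -> Ck_open k U f.
Proof.
elim: k f => [|k IH] f [df cdf].
  by move=> x Ux; apply: differentiable_continuous; exact: df.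
by split => // v; apply: IH.
Qed.

Lemma Ck_openW W k (f : V -> W) (U' : set V) : U' `<=` U ->
  Ck_open k U f -> Ck_open k U' f.
Proof.
move=> sU; elim: k f => [|k IH] f /=; first by move=> cf x /sU; apply: cf.
by move=> [df cdf]; split => [x /sU|v]; [apply: df | apply: IH].
Qed.

Lemma Ck_open_cst W k (a : W) : Ck_open k U (fun=> a).
Proof using oU.
elim: k a => [|k IH] a /=; first by move=> x _; exact: cst_continuous.
split => [x _|v]; first exact: differentiable_cst.
by apply: Ck_open_ext (IH 0) => x _; rewrite diff_cst.
Qed.

Lemma Ck_open_linear W k (f : {linear V -> W}) :
  continuous f -> Ck_open k U f.
Proof using oU.
case: k => [|k] cf /=; first by move=> x _; exact: cf.
split => [x _|v]; first exact: linear_differentiable.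
by apply: Ck_open_ext (Ck_open_cst k (f v)) => x _; rewrite diff_lin.
Qed.

Lemma Ck_openD W k (f g : V -> W) : Ck_open k U f -> Ck_open k U g ->
  Ck_open k U (fun x => f x + g x).
Proof using oU.
elim: k f g => [|k IH] f g /=.
  by move=> cf cg x Ux; apply: continuousD; [exact: cf|exact: cg].
move=> [df cdf] [dg cdg]; split=> [x Ux|v].
  by apply: differentiableD; [exact: df|exact: dg].
apply: Ck_open_ext (IH _ _ (cdf v) (cdg v)) => x Ux /=.
by rewrite (_ : (fun y => f y + g y) = f + g)// diffD//; [exact: df|exact: dg].
Qed.

Lemma Ck_open_sum W k n (f : 'I_n -> V -> W) :
  (forall i, Ck_open k U (f i)) -> Ck_open k U (fun x => \sum_i f i x).
Proof using oU.
elim: n f => [|n IH] f cf.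
  by apply: Ck_open_ext (Ck_open_cst k 0) => x _; rewrite big_ord0.
have : Ck_open k U (fun x => f ord0 x + \sum_i f (lift ord0 i) x).
  by apply: Ck_openD => //; exact: IH.
by apply: Ck_open_ext => x _; rewrite big_ord_recl.
Qed.

Lemma Ck_open_lincomp W Z k (L : {linear W -> Z}) (f : V -> W) :
  continuous L -> Ck_open k U f -> Ck_open k U (fun x => L (f x)).
Proof using oU.
move=> cL; elim: k f => [|k IH] f /=.
  by move=> cf x Ux; apply: (@continuous_comp _ _ _ f L); [exact: cf|exact: cL].
have dL y : differentiable L y by exact: linear_differentiable.
move=> [df cdf]; split=> [x Ux|v].
  by apply: (@differentiable_comp _ _ _ _ f L) => //; exact: df.
apply: Ck_open_ext (IH _ (cdf v)) => x Ux /=.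
rewrite (_ : (fun y => L (f y)) = L \o f)// (diff_comp (df x Ux) (dL (f x))).
by rewrite /= (diff_lin (f x) cL).
Qed.


Lemma scale_is_bilinear Y : bilinear_for
  (GRing.Scale.Law.clone _ _ *:%R _) (GRing.Scale.Law.clone _ _ *:%R _)
  (@GRing.scale R Y : R^o -> Y -> Y).
Proof.
split=> [u'|u] a x y /=; first by rewrite scalerDl scalerA.
by rewrite scalerDr !scalerA mulrC.
Qed.

Lemma is_diff_scale Y (s : V -> R^o) (f : V -> Y) x :
  differentiable s x -> differentiable f x ->
  is_diff x (fun y => s y *: f y) (fun v => s x *: 'd f x v + 'd s x v *: f x).
Proof.
move=> ds df.
(* The product rule is that of a continuous bilinear map composed with the pair (s, f). *)
pose bM := bilinear_isBilinear.Build _ _ _ _ _ _ _ (@scale_is_bilinear Y).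
pose b : {bilinear R^o -> Y -> Y} := HB.pack (@GRing.scale R Y : R^o -> Y -> Y) bM.
have cb : continuous (fun p : R^o * Y => b p.1 p.2).
  by move=> p; apply: scale_continuous.
have dp := differentiable_pair ds df.
have db := @differentiable_bilin _ _ _ _ b (s x, f x) cb.
split; first exact: (differentiable_comp dp db).
rewrite (_ : (fun y => s y *: f y) = (fun p => b p.1 p.2) \o (fun y => (s y, f y)))//.
by rewrite diff_comp// diff_bilin// diff_pair.
Qed.

(** Each term of the Leibniz rule has one undifferentiated factor, which the induction takes one
    order lower through [Ck_openS]. *)
Lemma Ck_openZ W k (s : V -> R^o) (f : V -> W) :
  Ck_open k U s -> Ck_open k U f -> Ck_open k U (fun x => s x *: f x).
Proof using oU.
elim: k s f => [|k IH] s f.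
  by move=> cs cf x Ux; apply: cvgZ; [exact: cs|exact: cf].
move=> cs cf; have [ds cds] := cs; have [df cdf] := cf.
split=> [x Ux|v].
  by have [] := is_diff_scale (ds x Ux) (df x Ux).
have := Ck_openD (IH _ _ (Ck_openS cs) (cdf v)) (IH _ _ (cds v) (Ck_openS cf)).
apply: Ck_open_ext => x Ux.
by have [_ ->] := is_diff_scale (ds x Ux) (df x Ux).
Qed.

Lemma Ck_openM k (f g : V -> R^o) :
  Ck_open k U f -> Ck_open k U g -> Ck_open k U (fun x => f x * g x : R^o).
Proof using oU. exact: Ck_openZ. Qed.

Lemma Ck_openN W k (f : V -> W) :
  Ck_open k U f -> Ck_open k U (fun x => - f x).
Proof using oU.
move=> cf; apply: Ck_open_ext (Ck_openZ (Ck_open_cst k (-1 : R^o)) cf) => x _.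
by rewrite scaleN1r.
Qed.

(** The differential -(1/f)^2 df contains 1/f itself, so each order of regularity of 1/f yields the
    next one. *)
Lemma Ck_openV k (f : V -> R^o) : (forall x, U x -> f x != 0) ->
  Ck_open k U f -> Ck_open k U (fun x => (f x)^-1 : R^o).
Proof using oU.
move=> f0; elim: k => [|k IH] cf.
  by move=> x Ux; apply: cvgV; [exact: f0|exact: cf].
have [df cdf] := cf; have ci := IH (Ck_openS cf).
split=> [x Ux|v]; first by apply: differentiableV; [exact: df|exact: f0].
apply: Ck_open_ext (Ck_openN (Ck_openM (Ck_openM ci ci) (cdf v))) => x Ux.
rewrite diffV//; [|exact: df|exact: f0].
by rewrite /= -exprVn expr2 scaleNr.
Qed.

Lemma Ck_open_pair W Z k (f : V -> W) (g : V -> Z) :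
  Ck_open k U f -> Ck_open k U g -> Ck_open k U (fun x => (f x, g x)).
Proof using oU.
elim: k f g => [|k IH] f g.
  by move=> cf cg x Ux; apply: cvg_pair; [exact: cf|exact: cg].
move=> [df cdf] [dg cdg]; split=> [x Ux|v].
  by apply: differentiable_pair; [exact: df|exact: dg].
apply: Ck_open_ext (IH _ _ (cdf v) (cdg v)) => x Ux.
by rewrite diff_pair//; [exact: df|exact: dg].
Qed.

End OpenSet.
End Calculus.

(** * Chain rule and smoothness on arbitrary subsets *)

Section FiniteDim.
Context {R : realType}.
Implicit Types V W Z : normedModType R.

Lemma Ck_open_linear_comp V W Z (U : set V) k (L : W -> Z) (f : V -> W) :
  open U -> linear L -> continuous L -> Ck_open k U f ->
  Ck_open k U (fun x => L (f x)).
Proof.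
move=> oU linL cL; pose LM := GRing.isLinear.Build _ _ _ _ _ linL.
pose L' : {linear W -> Z} := HB.pack L LM.
exact: (@Ck_open_lincomp _ _ _ oU _ _ _ L').
Qed.

(** [Ck_open] differentiates along fixed directions, while the chain rule differentiates the outer
    map along the moving direction ['d f x v]. Continuous coordinates turn that direction into a
    finite combination of fixed ones. *)
Definition fin_dim W := exists n (e : 'I_n -> W) (phi : 'I_n -> W -> R^o),
  [/\ forall i, linear (phi i), forall i, continuous (phi i)
    & forall w, w = \sum_i phi i w *: e i].

Lemma fin_dim_rV n : fin_dim 'rV[R]_n.
Proof.
exists n, (fun i => delta_mx 0 i),
  (fun i (w : 'rV[R]_n) => w 0 i : R^o); split.
- by move=> i a u v; rewrite !mxE.
- by move=> i; exact: coord_continuous.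
- by move=> w; rewrite -row_sum_delta.
Qed.


Lemma fin_dim_prod W Z : fin_dim W -> fin_dim Z -> fin_dim (W * Z)%type.
Proof.
move=> [n [e [phi [lphi cphi ephi]]]] [m [f [psi [lpsi cpsi epsi]]]].
exists (n + m)%N, (fun i : 'I_(n + m) => match fintype.split i with
    | inl i => (e i, 0) | inr j => (0, f j) end),
  (fun (i : 'I_(n + m)) w => match fintype.split i with inl i => phi i w.1 
     | inr j => psi j w.2 end).
split => [i|i|w].
- by case: (fintype.split i) => j a u v /=; rewrite (lphi, lpsi).
- case: (fintype.split i) => j x.
  + by apply: (@continuous_comp _ _ _ fst (phi j)); [exact: cvg_fst|exact: cphi].
  + by apply: (@continuous_comp _ _ _ snd (psi j)); [exact: cvg_snd|exact: cpsi].
- rewrite big_split_ord/=.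
  under eq_bigr do rewrite (unsplitK (inl _)).
  under [X in _ + X]eq_bigr do rewrite (unsplitK (inr _)).
  have -> : \sum_i phi i w.1 *: ((e i, 0) : W * Z) = (w.1, 0).
    rewrite [in RHS](ephi w.1); elim/big_rec2 : _ => [//|i u v _ ->].
    by congr (_, _); rewrite /= scaler0 addr0.
  have -> : \sum_i psi i w.2 *: ((0, f i) : W * Z) = (0, w.2).
    rewrite [in RHS](epsi w.2); elim/big_rec2 : _ => [//|i u v _ ->].
    by congr (_, _); rewrite /= scaler0 addr0.
  by case: w => x y; congr (_, _); rewrite /= ?addr0 ?add0r.
Qed.

Lemma open_preimage_on V W (U : set V) (U' : set W) (f : V -> W) :
  open U -> (forall x, U x -> {for x, continuous f}) -> open U' ->
  open (U `&` f @^-1` U').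
Proof.
move=> oU cf oU'; rewrite openE => x [Ux U'fx].
apply: filterI; first exact: open_nbhs_nbhs.
by apply: cf => //; exact: open_nbhs_nbhs.
Qed.

Lemma Ck_open_comp V W Z (U : set V) (U' : set W) k (f : V -> W) (g : W -> Z) :
  fin_dim W -> open U -> open U' -> (forall x, U x -> U' (f x)) ->
  Ck_open k U f -> Ck_open k U' g -> Ck_open k U (g \o f).
Proof.
move=> [n [e [phi [lphi cphi ephi]]]] oU oU' fU.
elim: k g => [|k IH] g.
  by move=> cf cg x Ux; apply: continuous_comp; [exact: cf|exact/cg/fU].
move=> cf cg; have [df cdf] := cf; have [dg cdg] := cg.
split=> [x Ux|v].
  by apply: differentiable_comp; [exact: df|exact/dg/fU].
have := Ck_open_sum oU (fun i => Ck_openZ oU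
  (Ck_open_linear_comp oU (lphi i) (cphi i) (cdf v))
  (IH _ (Ck_openS cf) (cdg (e i)))).
apply: (Ck_open_ext oU) => x Ux /=.
rewrite (diff_comp (df x Ux) (dg _ (fU x Ux))) /= [in RHS](ephi ('d f x v)).
by rewrite linear_sum; apply: eq_bigr => i _; rewrite linearZ.
Qed.

Lemma smooth_open_continuous V W (U : set V) (f : V -> W) :
  smooth_open U f -> forall x, U x -> {for x, continuous f}.
Proof. by move=> /(_ 0%N). Qed.

Lemma smooth_open_differentiable V W (U : set V) (f : V -> W) :
  smooth_open U f -> forall x, U x -> differentiable f x.
Proof. by move=> /(_ 1%N)[]. Qed.

Lemma smooth_open_comp V W Z (U : set V) (U' : set W) (f : V -> W) (g : W -> Z) :
  fin_dim W -> open U -> open U' -> (forall x, U x -> U' (f x)) ->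
  smooth_open U f -> smooth_open U' g -> smooth_open U (g \o f).
Proof. by move=> dW oU oU' fU sf sg k; apply: (Ck_open_comp dW oU oU' fU). Qed.

Lemma smooth_extension_comp V W Z (A : set V) (B : set W) (f : V -> W) (g : W -> Z)
    x U U' F G :
  fin_dim W -> (forall y, A y -> B (f y)) -> A x ->
  smooth_extension A f x U F -> smooth_extension B g (f x) U' G ->
  smooth_extension A (g \o f) x (U `&` F @^-1` U') (G \o F).
Proof.
move=> dW fAB Ax [oU Ux sF FA] [oU' Ux' sG GB].
have oUF := open_preimage_on oU (smooth_open_continuous sF) oU'.
split => //.
- by split => //=; rewrite FA.
- apply: smooth_open_comp sG => // [y []//|k].
  by apply: Ck_openW (sF k) => y [].
- move=> y Ay [Uy /=]; rewrite FA// => U'y.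
  by apply: GB => //; exact: fAB.
Qed.

Lemma smooth_on_comp V W Z (A : set V) (B : set W) (f : V -> W) (g : W -> Z) :
  fin_dim W -> (forall x, A x -> B (f x)) ->
  smooth_on A f -> smooth_on B g -> smooth_on A (g \o f).
Proof.
move=> dW fAB sf sg x Ax; have [U [F FP]] := sf x Ax.
have [U' [G GP]] := sg _ (fAB _ Ax).
by exists (U `&` F @^-1` U'), (G \o F); apply: smooth_extension_comp FP GP.
Qed.

Lemma smooth_on_sub V W (A B : set V) (f : V -> W) :
  B `<=` A -> smooth_on A f -> smooth_on B f.
Proof.
move=> BA sf x /BA /sf [U [F [oU Ux sF FA]]].
by exists U, F; split => // y /BA; exact: FA.
Qed.

Lemma smooth_open_on V W (U A : set V) (f : V -> W) :
  open U -> A `<=` U -> smooth_open U f -> smooth_on A f.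
Proof. by move=> oU AU sf x Ax; exists U, f; split => //; exact: AU. Qed.

Lemma smooth_on_continuous V W (A : set V) (f : V -> W) :
  smooth_on A f -> {within A, continuous f}.
Proof.
move=> sf; apply/subspace_continuousP => x Ax.
have [U [F [oU Ux sF FA]]] := sf x Ax.
change (f @ within A (nbhs x) --> f x); rewrite -(FA x Ax Ux).
have cF : F @ within A (nbhs x) --> F x.
  apply: cvg_within_filter; exact: (smooth_open_continuous sF Ux).
apply: cvg_trans cF.
apply: near_eq_cvg; rewrite near_withinE.
have : nbhs x U by exact: open_nbhs_nbhs.
by apply: filterS => y Uy Ay; exact: FA.
Qed.
End FiniteDim.

(** * Closure properties of smooth maps *)

Section SmoothAlgebra.
Context {R : realType} {V : normedModType R} (U : set V) (oU : open U).
Implicit Types (W Z : normedModType R).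

Lemma smooth_open_ext W (f g : V -> W) :
  (forall x, U x -> f x = g x) -> smooth_open U f -> smooth_open U g.
Proof using oU. by move=> fg sf k; exact: (Ck_open_ext oU fg). Qed.

Lemma smooth_openW W (U' : set V) (f : V -> W) :
  U' `<=` U -> smooth_open U f -> smooth_open U' f.
Proof. by move=> sU sf k; exact: (Ck_openW sU). Qed.

Lemma smooth_open_cst W (a : W) : smooth_open U (fun=> a).
Proof using oU. by move=> k; exact: Ck_open_cst. Qed.

Lemma smooth_open_linear_comp W Z (L : W -> Z) (f : V -> W) :
  linear L -> continuous L -> smooth_open U f -> smooth_open U (fun x => L (f x)).
Proof using oU. by move=> lL cL sf k; exact: Ck_open_linear_comp. Qed.

Lemma smooth_open_id : smooth_open U id.
Proof using oU.
by move=> k; exact: (Ck_open_linear oU k (f := idfun) (fun x => @cvg_id _ _)).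
Qed.

Lemma smooth_openD W (f g : V -> W) : smooth_open U f -> smooth_open U g ->
  smooth_open U (fun x => f x + g x).
Proof using oU. by move=> sf sg k; exact: Ck_openD. Qed.

Lemma smooth_openN W (f : V -> W) : smooth_open U f ->
  smooth_open U (fun x => - f x).
Proof using oU. by move=> sf k; exact: Ck_openN. Qed.

Lemma smooth_open_sum W n (f : 'I_n -> V -> W) :
  (forall i, smooth_open U (f i)) -> smooth_open U (fun x => \sum_i f i x).
Proof using oU. by move=> sf k; apply: Ck_open_sum => // i; exact: sf. Qed.

Lemma smooth_openZ W (s : V -> R^o) (f : V -> W) :
  smooth_open U s -> smooth_open U f -> smooth_open U (fun x => s x *: f x).
Proof using oU. by move=> ss sf k; exact: Ck_openZ. Qed.

Lemma smooth_openM (f g : V -> R^o) :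
  smooth_open U f -> smooth_open U g -> smooth_open U (fun x => f x * g x : R^o).
Proof using oU. by move=> sf sg k; exact: Ck_openM. Qed.

Lemma smooth_openX (f : V -> R^o) n :
  smooth_open U f -> smooth_open U (fun x => f x ^+ n : R^o).
Proof using oU.
move=> sf; elim: n => [|n IH]; first exact: smooth_open_cst.
by apply: smooth_open_ext (smooth_openM sf IH) => x _; rewrite exprS.
Qed.

Lemma smooth_openV (f : V -> R^o) : (forall x, U x -> f x != 0) ->
  smooth_open U f -> smooth_open U (fun x => (f x)^-1 : R^o).
Proof using oU. by move=> f0 sf k; exact: Ck_openV. Qed.

Lemma smooth_open_pair W Z (f : V -> W) (g : V -> Z) :
  smooth_open U f -> smooth_open U g -> smooth_open U (fun x => (f x, g x)).
Proof using oU. by move=> sf sg k; exact: Ck_open_pair. Qed.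

Lemma smooth_open_fst W Z (f : V -> W * Z) :
  smooth_open U f -> smooth_open U (fun x => (f x).1).
Proof using oU.
by apply: (@smooth_open_linear_comp _ _ fst) => // x; exact: cvg_fst.
Qed.

Lemma smooth_open_snd W Z (f : V -> W * Z) :
  smooth_open U f -> smooth_open U (fun x => (f x).2).
Proof using oU.
by apply: (@smooth_open_linear_comp _ _ snd) => // x; exact: cvg_snd.
Qed.

Lemma smooth_open_coord n (f : V -> 'rV[R]_n) i :
  smooth_open U f -> smooth_open U (fun x => f x 0 i : R^o).
Proof using oU.
apply: (@smooth_open_linear_comp _ _ (fun w : 'rV[R]_n => w 0 i : R^o)).
  by move=> a u v; rewrite !mxE.
exact: coord_continuous.
Qed.

Lemma smooth_open_row n (f : V -> 'rV[R]_n) :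
  (forall i, smooth_open U (fun x => f x 0 i : R^o)) -> smooth_open U f.
Proof using oU.
move=> sf.
have sD i : smooth_open U (fun x => (f x 0 i : R^o) *: (delta_mx 0 i : 'rV[R]_n)).
  by apply: smooth_openZ => //; exact: smooth_open_cst.
by apply: smooth_open_ext (smooth_open_sum sD) => x _; rewrite -row_sum_delta.
Qed.

End SmoothAlgebra.

(** * Smooth dependence of a continuous cubic root *)

Section CubicRoot.
Context {R : realType} {V : normedModType R}.

(** Since a = O(h) at x, mere continuity of b makes a (b - b x) an o(h). This differentiates
    quantities known only to be continuous, such as an implicit root. *)
Lemma is_diff_mul_vanishing (a b a' : V -> R^o) (x : V) :
  is_diff x a a' -> {for x, continuous b} -> a x = 0 ->
  is_diff x (fun y => a y * b y : R^o) (fun v => a' v * b x : R^o).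
Proof.
move=> [da <-] cb ax0.
have lin0 : linear (fun v => 'd a x v * b x : R^o).
  by move=> k u v; rewrite linearP mulrDl scalerAl.
pose LM := GRing.isLinear.Build _ _ _ _ _ lin0.
pose L : {linear V -> R^o} := HB.pack (fun v => 'd a x v * b x : R^o) LM.
have cL : continuous L.
  move=> v; apply: (@cvgM _ _ (nbhs v) _ ('d a x) (cst (b x))).
    exact: diff_continuous.
  exact: cvg_cst.
have loc : (fun y => a y * b y : R^o) \o shift x =
    cst (a x * b x) + L +o_ 0 id.
  (* The constant is k + 1: [k] bounds the linear part and 1 the remainder. *)
  have [C C0 aC] : exists2 C : R, 0 < C & \forall h \near (0 : V), `|a (h + x)| <= C * `|h|.
    have [k k0 kP] := linear_lipschitz (@diff_continuous _ _ _ _ _ da).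
    exists (k + 1); first by rewrite addr_gt0.
    have /eqaddoP /(_ 1 ltr01) := diff_locally da.
    apply: filterS => h; rewrite !fctE /= ax0 add0r mul1r => ha.
    rewrite mulrDl mul1r -(subrK ('d a x h) (a (h + x))) addrC.
    by apply: (le_trans (ler_normD _ _)); rewrite lerD// kP.
  (* The added 1 keeps the divisor positive when b vanishes at x. *)
  have B0 : 0 < `|b x| + 1 by rewrite ltr_wpDl.
  have /eqaddoP da0 := diff_locally da.
  have cb0 : b (h + x) @[h --> 0] --> b x.
    have : h + x @[h --> (0 : V)] --> x.
      by rewrite -[X in _ --> X]add0r; apply: cvgD; [exact: cvg_id|exact: cvg_cst].
    by move=> /cvg_comp; apply; exact: cb.
  apply/eqaddoP => e e0; near=> h.
  rewrite !fctE /= ax0 mul0r add0r.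
  have -> : a (h + x) * b (h + x) - 'd a x h * b x =
    a (h + x) * (b (h + x) - b x) + (a (h + x) - 'd a x h) * b x by ring.
  rewrite [in leRHS](splitr e) [in leRHS]mulrDl; apply: (le_trans (ler_normD _ _)).
  rewrite !normrM; apply: lerD.
    have h1 : `|a (h + x)| <= C * `|h| by near: h.
    have h2 : `|b (h + x) - b x| <= e / 2 / C.
      rewrite distrC; near: h; move: cb0 => /cvgrPdist_le; apply.
      by rewrite !divr_gt0.
    apply: (le_trans (ler_pM _ _ h1 h2)) => //.
    by rewrite le_eqVlt; apply/orP; left; apply/eqP; field; rewrite gt_eqF.
  have h1 : `|a (h + x) - 'd a x h| <= e / 2 / (`|b x| + 1) * `|h|.
    near: h; have := da0 (e / 2 / (`|b x| + 1)); rewrite !divr_gt0// => /(_ isT).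
    by apply: filterS => h; rewrite !fctE /= ax0 add0r.
  apply: (@le_trans _ _ (e / 2 / (`|b x| + 1) * `|h| * (`|b x| + 1))).
    by apply: ler_pM => //; rewrite lerDl.
  by rewrite le_eqVlt; apply/orP; left; apply/eqP; field; rewrite gt_eqF.
split; last exact: (diff_unique cL loc).
by apply/diff_locallyP; rewrite (diff_unique cL loc).
Unshelve. all: by end_near. Qed.

(** Subtracting the two root equations leaves the increment of the first cubic between [s] and [r];
    the last factor is its divided difference, equal to the derivative when s = r. *)
Lemma cubic_secantE (a b g a' b' g' r s : R) :
  a * r + b * r ^+ 2 + g * r ^+ 3 = 1 ->
  a' * s + b' * s ^+ 2 + g' * s ^+ 3 = 1 ->
  (a' - a) * s + (b' - b) * s ^+ 2 + (g' - g) * s ^+ 3 =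
  (r - s) * (a + b * (s + r) + g * (s * s + s * r + r ^+ 2)).
Proof.
move=> Er Es.
transitivity ((a' * s + b' * s ^+ 2 + g' * s ^+ 3) -
    (a * r + b * r ^+ 2 + g * r ^+ 3) +
    (r - s) * (a + b * (s + r) + g * (s * s + s * r + r ^+ 2))); first by ring.
by rewrite Er Es subrr add0r.
Qed.

Lemma cubic_secant (a b g a' b' g' r s : R)
    (k := a + b * (s + r) + g * (s * s + s * r + r ^+ 2)) :
  a * r + b * r ^+ 2 + g * r ^+ 3 = 1 ->
  a' * s + b' * s ^+ 2 + g' * s ^+ 3 = 1 -> k != 0 ->
  r - ((a' - a) * (s ^+ 1 / k) + (b' - b) * (s ^+ 2 / k) +
    (g' - g) * (s ^+ 3 / k)) = s.
Proof.
move=> Er Es; have := cubic_secantE Er Es; rewrite -/k; move: (k) => {}k E k0.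
have -> : (a' - a) * (s ^+ 1 / k) + (b' - b) * (s ^+ 2 / k) + (g' - g) * (s ^+ 3 / k)
  = ((a' - a) * s + (b' - b) * s ^+ 2 + (g' - g) * s ^+ 3) / k by field.
by rewrite E mulfK// subKr.
Qed.

(** By [cubic_secant], the increment of rho is a sum of coefficient increments, which vanish at x,
    times factors that are continuous because rho is; [is_diff_mul_vanishing] handles each term. *)
Lemma is_diff_cubic_root (al be ga rho : V -> R^o) (x : V)
    (D : R := al x + 2 * be x * rho x + 3 * ga x * rho x ^+ 2) :
  differentiable al x -> differentiable be x -> differentiable ga x ->
  {for x, continuous rho} ->
  (\near x, al x * rho x + be x * rho x ^+ 2 + ga x * rho x ^+ 3 = 1) ->
  D != 0 ->
  is_diff x rho (fun v => - ('d al x v * (rho x / D) +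
    'd be x v * (rho x ^+ 2 / D) + 'd ga x v * (rho x ^+ 3 / D)) : R^o).
Proof.
move=> dal dbe dga crho rhoP D0.
pose K y : R^o :=
  al x + be x * (rho y + rho x) + ga x * (rho y * rho y + rho y * rho x + rho x ^+ 2).
have cK : {for x, continuous K}.
  apply: cvgD; first apply: cvgD; [exact: cvg_cst| |].
    by apply: cvgM; [exact: cvg_cst|apply: cvgD; [exact: crho|exact: cvg_cst]].
  apply: cvgM; first exact: cvg_cst.
  apply: cvgD; last exact: cvg_cst.
  by apply: cvgD; apply: cvgM; (exact: crho || exact: cvg_cst).
have KD : K x = D by rewrite /K /D; ring.
have cX n : {for x, continuous (fun y => rho y ^+ n / K y : R^o)}.
  apply: cvgM; last by apply: cvgV; [rewrite KD|exact: cK].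
  by apply: (@continuous_comp _ _ _ rho (fun z : R^o => z ^+ n)) => //; exact: exprn_continuous.
have vanish (a : V -> R^o) n : differentiable a x ->
    is_diff x (fun y => (a y - a x) * (rho y ^+ n / K y) : R^o)
      (fun v => 'd a x v * (rho x ^+ n / D) : R^o).
  move=> da.
  have db := is_diffB (differentiableP da) (is_diff_cst (a x : R^o) x).
  have := is_diff_mul_vanishing db (cX n) (subrr (a x)).
  move=> /is_diff_eq; apply; apply/funext => v.
  by rewrite KD; congr (_ * _); exact: subr0.
have [dF eF] := is_diffD (is_diff_cst (rho x : R^o) x) (is_diffN (is_diffD
  (is_diffD (vanish al 1%N dal) (vanish be 2%N dbe)) (vanish ga 3%N dga))).
have Frho := near_eq_is_diff (g := rho) dF.
apply: is_diff_eq (Frho _) _; last first.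
  by apply: (etrans eF); apply/funext => v; exact: add0r.
near=> y.
rewrite -[LHS]/(rho x + - ((al y - al x) * (rho y ^+ 1 / K y) +
  (be y - be x) * (rho y ^+ 2 / K y) + (ga y - ga x) * (rho y ^+ 3 / K y))).
have Ky : K y != 0.
  near: y; have : K x != 0 by rewrite KD.
  by move=> Kx; have := cvgr_neq0 (K x) cK Kx; exact.
have rx : al x * rho x + be x * rho x ^+ 2 + ga x * rho x ^+ 3 = 1.
  exact: nbhs_singleton rhoP.
have ry : al y * rho y + be y * rho y ^+ 2 + ga y * rho y ^+ 3 = 1.
  by near: y.
exact: (cubic_secant rx ry Ky).
Unshelve. all: by end_near. Qed.

(** The differential of rho is polynomial in rho, the differentials of the coefficients and 1/D, so
    C^k regularity of rho gives C^(k+1). *)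
Lemma smooth_cubic_root (U : set V) (al be ga rho : V -> R^o) : open U ->
  smooth_open U al -> smooth_open U be -> smooth_open U ga ->
  (forall x, U x -> {for x, continuous rho}) ->
  (forall x, U x -> al x * rho x + be x * rho x ^+ 2 + ga x * rho x ^+ 3 = 1) ->
  (forall x, U x -> al x + 2 * be x * rho x + 3 * ga x * rho x ^+ 2 != 0) ->
  smooth_open U rho.
Proof.
move=> oU sal sbe sga crho rhoP D0.
pose D x : R := al x + 2 * be x * rho x + 3 * ga x * rho x ^+ 2.
have drho x : U x -> is_diff x rho (fun v => - ('d al x v * (rho x / D x) +
    'd be x v * (rho x ^+ 2 / D x) + 'd ga x v * (rho x ^+ 3 / D x)) : R^o).
  move=> Ux; apply: is_diff_cubic_root (D0 x Ux); last first.
  - by apply: filterS rhoP _; exact: open_nbhs_nbhs.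
  - exact: crho.
  - exact: smooth_open_differentiable sga x Ux.
  - exact: smooth_open_differentiable sbe x Ux.
  - exact: smooth_open_differentiable sal x Ux.
elim=> [|k IH]; first exact: crho.
split=> [x Ux|v]; first by have [] := drho x Ux.
have CV : Ck_open k U (fun x => (D x)^-1 : R^o).
  apply: Ck_openV => //; apply: Ck_openD => //.
    apply: Ck_openD => //; apply: Ck_openM => //.
    by apply: Ck_openM => //; exact: Ck_open_cst.
  apply: Ck_openM => //; first by apply: Ck_openM => //; exact: Ck_open_cst.
  by apply: Ck_open_ext (Ck_openM oU IH IH) => // x _; rewrite expr2.
have da (a : V -> R^o) : smooth_open U a -> Ck_open k U (fun x => 'd a x v).
  by move=> /(_ k.+1)[_ /(_ v)].
have := Ck_openN oU (Ck_openM oU (Ck_openM oU IH (Ck_openD oU (Ck_openD oU (da _ sal)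
  (Ck_openM oU (da _ sbe) IH)) (Ck_openM oU (da _ sga) (Ck_openM oU IH IH)))) CV).
apply: (Ck_open_ext oU) => x Ux; have [_ e] := drho x Ux.
apply: (etrans _ (esym (congr1 (@^~ v) e))) => /=.
have L (p q s r d : R) : - (r * (p + q * r + s * (r * r)) * d) =
  - (p * (r * d) + q * (r ^+ 2 * d) + s * (r ^+ 3 * d)) by ring.
exact: (L ('d al x v) ('d be x v) ('d ga x v) (rho x) (D x)^-1).
Qed.
End CubicRoot.

(** * Implicit roots of cubics *)

Section CubicImplicit.
Context {R : realType} {V : normedModType R}.

Lemma cubic_IVT (a b g r s : R) : r <= s ->
  a * r + b * r ^+ 2 + g * r ^+ 3 <= 1 -> 1 <= a * s + b * s ^+ 2 + g * s ^+ 3 ->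
  exists2 t, r <= t <= s & a * t + b * t ^+ 2 + g * t ^+ 3 = 1.
Proof.
move=> rs Gr Gs; pose G t := a * t + b * t ^+ 2 + g * t ^+ 3.
have cG : {within `[r, s], continuous G}.
  apply: continuous_subspaceT => t.
  have cX n : {for t, continuous (fun t : R => t ^+ n)} by exact: exprn_continuous.
  apply: cvgD; first apply: cvgD.
  - by apply: cvgM; [exact: cvg_cst|exact: cvg_id].
  - by apply: cvgM; [exact: cvg_cst|exact: cX].
  - by apply: cvgM; [exact: cvg_cst|exact: cX].
have [] := @IVT _ G r s 1 rs cG.
  by rewrite ge_min le_max /G Gr Gs orbT.
by move=> t; rewrite in_itv/= => tI Gt; exists t.
Qed.

(** An implicit function theorem for a simple root; the tolerance [e] lets the root be kept inside a
    prescribed open range. *)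
Lemma cubic_implicit (U : set V) (al be ga : V -> R^o) (x0 : V) (r0 e : R) :
  open U -> U x0 -> 0 < e ->
  smooth_open U al -> smooth_open U be -> smooth_open U ga ->
  al x0 * r0 + be x0 * r0 ^+ 2 + ga x0 * r0 ^+ 3 = 1 ->
  0 < al x0 + 2 * be x0 * r0 + 3 * ga x0 * r0 ^+ 2 ->
  exists (U' : set V) (F : V -> R^o),
    [/\ open U', U' x0, U' `<=` U, smooth_open U' F &
      forall y, U' y -> `|F y - r0| < e /\
        al y * F y + be y * F y ^+ 2 + ga y * F y ^+ 3 = 1].
Proof.
move=> oU Ux0 e0 sal sbe sga G0 D0.
set D := (X in 0 < X) in D0.
have cal y : U y -> {for y, continuous al} by exact: smooth_open_continuous sal y.
have cbe y : U y -> {for y, continuous be} by exact: smooth_open_continuous sbe y.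
have cga y : U y -> {for y, continuous ga} by exact: smooth_open_continuous sga y.
pose G y r : R := al y * r + be y * r ^+ 2 + ga y * r ^+ 3.
(* Divided difference of [G y] between [r] and [s]. Its positivity near (r0, r0) gives the signs at
   both ends, and later a Lipschitz bound for the root. *)
pose K (y : V) (s r : R) : R :=
  al y + be y * (s + r) + ga y * (s * s + s * r + r ^+ 2).
have KD y r : K y r r = al y + 2 * be y * r + 3 * ga y * r ^+ 2 by rewrite /K; ring.
pose Kf (p : V * (R * R)) : R := K p.1 p.2.1 p.2.2.
have cKf : {for (x0, (r0, r0)), continuous Kf}.
  have c1 (a : V -> R^o) : {for x0, continuous a} ->
      {for (x0, (r0, r0)), continuous (fun p : V * (R * R) => a p.1)}.
    by move=> ca; apply: continuous_comp => //; exact: cvg_fst.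
  have cs : {for (x0, (r0, r0)), continuous (fun p : V * (R * R) => p.2.1)}.
    by apply: (@continuous_comp _ _ _ snd fst); [exact: cvg_snd|exact: cvg_fst].
  have cr : {for (x0, (r0, r0)), continuous (fun p : V * (R * R) => p.2.2)}.
    by apply: (@continuous_comp _ _ _ snd snd); [exact: cvg_snd|exact: cvg_snd].
  rewrite /Kf /K; apply: cvgD; first apply: cvgD; first exact/c1/cal.
    by apply: cvgM; [exact/c1/cbe|apply: cvgD; [exact: cs|exact: cr]].
  apply: cvgM; first exact/c1/cga.
  apply: cvgD; first by apply: cvgD; apply: cvgM; (exact: cs || exact: cr).
  by apply: (cvgM cr cr).
have [A [d [nA d0 de KP]]] : exists (A : set V) (d : R), [/\ nbhs x0 A, 0 < d, d < e &
    forall y s r, A y -> `|s - r0| <= d -> `|r - r0| <= d -> D / 2 < K y s r].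
  have : \forall p \near (x0, (r0, r0)), D / 2 < Kf p.
    apply: (cvgr_gt (Kf (x0, (r0, r0))) cKf).
    by rewrite /Kf /= KD -/D ltr_pdivrMr// mulr_natr mulr2n ltrDl.
  move=> [[P Q] [/= nP [[Q1 Q2] [/= nQ1 nQ2] Q12]] PQ].
  have /nbhs_ballP[d1 /= d10 B1] := nQ1.
  have /nbhs_ballP[d2 /= d20 B2] := nQ2.
  (* Halving puts the closed interval of radius [d] inside the open balls and makes [d < e]. *)
  pose d := Num.min e (Num.min d1 d2) / 2.
  have m0 : 0 < Num.min e (Num.min d1 d2) by rewrite !lt_min e0 d10 d20.
  have dm : d < Num.min e (Num.min d1 d2) by rewrite /d ltr_pdivrMr// mulr_natr mulr2n ltrDl.
  move: (dm); rewrite !lt_min => /and3P[de dd1 dd2].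
  exists P, d; split => //; first by rewrite divr_gt0.
  move=> y s r Py sd rd; apply: (PQ (y, (s, r))); split => //=.
  apply: Q12; split => /=.
    by apply: B1; rewrite /ball/= distrC; exact: le_lt_trans dd1.
  by apply: B2; rewrite /ball/= distrC; exact: le_lt_trans dd2.
have cG r y : U y -> {for y, continuous (G ^~ r)}.
  move=> Uy; apply: cvgD; first apply: cvgD.
  - by apply: cvgM; [exact: cal|exact: cvg_cst].
  - by apply: cvgM; [exact: cbe|exact: cvg_cst].
  - by apply: cvgM; [exact: cga|exact: cvg_cst].
have GK y r s : G y s - G y r = (s - r) * K y s r by rewrite /G /K; ring.
have Ax0 := nbhs_singleton nA.
have D20 : 0 < D / 2 by rewrite divr_gt0.
have Gp : 1 < G x0 (r0 + d).
  rewrite -G0 -subr_gt0 -/(G x0 r0) GK addrAC subrr add0r mulr_gt0//.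
  apply: (lt_trans D20); apply: KP => //; last by rewrite subrr normr0 ltW.
  by rewrite addrAC subrr add0r gtr0_norm.
have Gm : G x0 (r0 - d) < 1.
  rewrite -G0 -subr_lt0 -/(G x0 r0) GK addrAC subrr add0r mulNr oppr_lt0 mulr_gt0//.
  apply: (lt_trans D20); apply: KP => //; last by rewrite subrr normr0 ltW.
  by rewrite addrAC subrr add0r normrN gtr0_norm.
(* Where the cubic still straddles the value 1 between the two ends, the intermediate value theorem
   gives a root. *)
pose B := [set y | [/\ U y, A y, 1 < G y (r0 + d) & G y (r0 - d) < 1]].
have nB : nbhs x0 B.
  have nU : nbhs x0 U by exact: open_nbhs_nbhs.
  near=> y; split; near: y; [exact: nU|exact: nA| |].
  - exact: (cvgr_gt _ (cG _ _ Ux0)).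
  - exact: (cvgr_lt _ (cG _ _ Ux0)).
pose F y : R := xget r0 [set r | `|r - r0| <= d /\ G y r = 1].
have FP y : B y -> `|F y - r0| <= d /\ G y (F y) = 1.
  move=> [_ _ yp ym]; rewrite /F; case: xgetP => [_ _ //|/(_ _)].
  have [|||r rI Gr] := @cubic_IVT (al y) (be y) (ga y) (r0 - d) (r0 + d).
  - by rewrite lerD2l; apply: (@le_trans _ _ 0); rewrite ?oppr_le0; apply: ltW.
  - exact: ltW.
  - exact: ltW.
  by move=> /(_ r); case; split => //; rewrite ler_distl.
exists (interior B), F; split.
- exact: open_interior.
- exact: nB.
- by move=> y /interior_subset[].
- have oB : open (interior B) by exact: open_interior.
  have BU : interior B `<=` U by move=> y /interior_subset[].
  apply: (smooth_cubic_root oB (smooth_openW BU sal) (smooth_openW BU sbe) (smooth_openW BU sga)).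
  + move=> y /[dup] By /interior_subset By'; have [Uy Ay _ _] := By'.
    have [Fyd GFy] := FP y By'.
    (* [M] bounds the root on [B], so the secant identity bounds |F y - F z| D/2 by the coefficient
       increments weighted by powers of [M]; [E] is this bound divided by D/2. *)
    pose M := `|r0| + d.
    pose E z : R := (`|al z - al y| * M + `|be z - be y| * M ^+ 2 +
      `|ga z - ga y| * M ^+ 3) / (D / 2).
    have cE : E z @[z --> y] --> (0 : R).
      have ca (a : V -> R^o) : {for y, continuous a} -> `|a z - a y| @[z --> y] --> (0 : R).
        move=> cay; rewrite -(normr0 R) -(subrr (a y)).
        by apply: cvg_norm; apply: cvgB; [exact: cay|exact: cvg_cst].
      rewrite (_ : 0 = (0 * M + 0 * M ^+ 2 + 0 * M ^+ 3) / (D / 2) :> R); last first.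
        by rewrite !mul0r !addr0 mul0r.
      apply: cvgM; last exact: cvg_cst.
      by apply: cvgD; first apply: cvgD; (apply: cvgM; last exact: cvg_cst); apply: ca;
        [exact: cal|exact: cbe|exact: cga].
    apply/cvgrPdist_lt => eta eta0; near=> z.
    have Bz : B z by apply: interior_subset; near: z; exact: open_nbhs_nbhs.
    have [Fzd GFz] := FP z Bz.
    apply: (@le_lt_trans _ _ (E z)); last first.
      by near: z; exact: (cvgr_lt _ cE).
    rewrite /E ler_pdivlMr//.
    have := cubic_secantE GFy GFz.
    rewrite -/(K y (F z) (F y)) => secE.
    have Kp : D / 2 < K y (F z) (F y) by exact: KP.
    apply: (@le_trans _ _ (`|F y - F z| * K y (F z) (F y))).
      by rewrite ler_wpM2l// ltW.
    rewrite -[X in _ * X]gtr0_norm ?(lt_trans D20)// -normrM -secE.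
    have FM : `|F z| <= M.
      by rewrite -(subrK r0 (F z)) (le_trans (ler_normD _ _))// addrC lerD2l.
    have T (p : R) n : `|p * F z ^+ n| <= `|p| * M ^+ n.
      by rewrite normrM ler_wpM2l// normrX lerXn2r// nnegrE ?(le_trans _ FM).
    apply: (le_trans (ler_normD _ _)); apply: lerD; last exact: T.
    apply: (le_trans (ler_normD _ _)); apply: lerD; last exact: T.
    exact: (T _ 1%N).
  + by move=> y /interior_subset/FP[].
  + move=> y /interior_subset By; have [Fd _] := FP y By.
    have [Uy Ay _ _] := By; rewrite -KD gt_eqF//.
    by apply: (lt_trans D20); exact: KP.
- by move=> y /interior_subset/FP[Fd GF]; split => //; exact: le_lt_trans de.
Unshelve. all: by end_near. Qed.
End CubicImplicit.

(** * The cotangent bundle of the sphere *)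

Section Dot.
Context {R : realType}.

Section Bilinearity.
Variable n : nat.
Implicit Types u v w : 'rV[R]_n.

Lemma dotC u v : dot u v = dot v u.
Proof. by apply: eq_bigr => i _; rewrite mulrC. Qed.

Lemma dotDl u v w : dot (u + v) w = dot u w + dot v w.
Proof. by rewrite /dot -big_split; apply: eq_bigr => i _; rewrite mxE mulrDl. Qed.

Lemma dotZl a u w : dot (a *: u) w = a * dot u w.
Proof. by rewrite /dot mulr_sumr; apply: eq_bigr => i _; rewrite mxE mulrA. Qed.

Lemma dotDr u v w : dot w (u + v) = dot w u + dot w v.
Proof. by rewrite dotC dotDl !(dotC w). Qed.

Lemma dotZr a u w : dot w (a *: u) = a * dot w u.
Proof. by rewrite dotC dotZl dotC. Qed.

Lemma dotNl u w : dot (- u) w = - dot u w.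
Proof. by rewrite -scaleN1r dotZl mulN1r. Qed.

Lemma dotNr u w : dot w (- u) = - dot w u.
Proof. by rewrite dotC dotNl dotC. Qed.

Lemma dot0l w : dot 0 w = 0.
Proof. by rewrite -(scale0r w) dotZl mul0r. Qed.

Lemma dot0r w : dot w 0 = 0.
Proof. by rewrite dotC dot0l. Qed.

Lemma dot_ge0 u : 0 <= dot u u.
Proof. by apply: sumr_ge0 => i _; rewrite -expr2 sqr_ge0. Qed.

Lemma dot_eq0 u : (dot u u == 0) = (u == 0).
Proof.
apply/eqP/eqP => [|->]; last by rewrite dot0l.
move=> /eqP; rewrite psumr_eq0 => [/allP uu|i _]; last by rewrite -expr2 sqr_ge0.
apply/rowP => i; rewrite mxE; apply/eqP.
by have := uu i; rewrite mem_index_enum => /(_ isT) /=; rewrite mulf_eq0 orbb.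
Qed.

Lemma dot_gt0 u : (0 < dot u u) = (u != 0).
Proof. by rewrite lt_def dot_ge0 andbT dot_eq0. Qed.

Lemma enorm_eq1 u : enorm u = 1 <-> dot u u = 1.
Proof.
rewrite /enorm; split => [u1|->]; last by rewrite sqrtr1.
by rewrite -(sqr_sqrtr (dot_ge0 u)) u1 expr1n.
Qed.

Lemma enorm_ge0 u : 0 <= enorm u. Proof. exact: sqrtr_ge0. Qed.

Lemma sqr_enorm u : enorm u ^+ 2 = dot u u.
Proof. by rewrite sqr_sqrtr ?dot_ge0. Qed.

Lemma enorm_gt0 u : (0 < enorm u) = (u != 0).
Proof. by rewrite sqrtr_gt0 dot_gt0. Qed.

Lemma enormZ a u : enorm (a *: u) = `|a| * enorm u.
Proof. by rewrite /enorm dotZl dotZr mulrA -expr2 sqrtrM ?sqr_ge0// sqrtr_sqr. Qed.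

End Bilinearity.

Lemma cotangent_sphereP n (w : 'rV[R]_n.+1 * 'rV[R]_n.+1) :
  cotangent_sphere w <-> dot w.1 w.1 = 1 /\ dot w.1 w.2 = 0.
Proof. by rewrite /cotangent_sphere /= enorm_eq1. Qed.

Lemma unit_cotangent_sphereP n (w : 'rV[R]_n.+1 * 'rV[R]_n.+1) :
  unit_cotangent_sphere w <->
  [/\ dot w.1 w.1 = 1, dot w.1 w.2 = 0 & dot w.2 w.2 = 1].
Proof.
rewrite /unit_cotangent_sphere /= cotangent_sphereP enorm_eq1.
by split=> [[[]]|[]].
Qed.

Definition cons_row n (x : R) (b : 'rV[R]_n) : 'rV[R]_n.+1 :=
  row_mx (const_mx x : 'rV_1) b.

Definition tail_row n (u : 'rV[R]_n.+1) : 'rV[R]_n := rsubmx (u : 'rV_(1 + n)).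

Lemma cons_row0 n x (b : 'rV[R]_n) : cons_row x b 0 0 = x.
Proof.
by rewrite mxE; case: fintype.splitP => // j _; rewrite mxE.
Qed.

Lemma cons_rowK n x (b : 'rV[R]_n) : tail_row (cons_row x b) = b.
Proof. by rewrite /tail_row /cons_row row_mxKr. Qed.

Lemma tail_rowK n (u : 'rV[R]_n.+1) : cons_row (u 0 0) (tail_row u) = u.
Proof.
apply/rowP => i; rewrite mxE; case: fintype.splitP => j ij; rewrite !mxE;
  congr (u 0 _); apply: val_inj; first by move: ij; rewrite ord1 => /= ->.
by rewrite /= ij.
Qed.

Lemma dot_cons n x y (b d : 'rV[R]_n) :
  dot (cons_row x b) (cons_row y d) = x * y + dot b d.
Proof.
rewrite /dot big_ord_recl !cons_row0; congr (_ + _); apply: eq_bigr => i _.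
have E z (e : 'rV[R]_n) : cons_row z e 0 (lift ord0 i) = e 0 i.
  rewrite mxE; case: fintype.splitP => [j|j /= [ij]]; first by rewrite ord1.
  by congr (e 0 _); apply: val_inj.
by rewrite !E.
Qed.

Lemma scale_cons n a x (b : 'rV[R]_n) : a *: cons_row x b = cons_row (a * x) (a *: b).
Proof.
by apply/rowP => i; rewrite !mxE; case: fintype.splitP => j _; rewrite !mxE.
Qed.

Lemma stereoE n (X P : 'rV[R]_n) : stereo (X, P) =
  (cons_row ((dot X X - 1) / (dot X X + 1)) ((2 / (dot X X + 1)) *: X),
   cons_row (dot X P) (((dot X X + 1) / 2) *: P - dot X P *: X)).
Proof. by []. Qed.

(** The second component has entries eta_k (1 - xi_0) + xi_k eta_0, the g_k of the regularized
    Hamiltonian. Being polynomial, it is smooth across the pole, unlike the first component. *)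
Definition unstereo n (w : 'rV[R]_n.+1 * 'rV[R]_n.+1) : 'rV[R]_n * 'rV[R]_n :=
  ((1 - w.1 0 0)^-1 *: tail_row w.1,
   (1 - w.1 0 0) *: tail_row w.2 + w.2 0 0 *: tail_row w.1).

(** * Stereographic projection of covectors *)

Section Stereo.
Variables (n : nat).
Implicit Types (X P : 'rV[R]_n).

Lemma dotS_gt0 X : 0 < dot X X + 1.
Proof. by rewrite ltr_wpDl ?dot_ge0. Qed.
Hint Resolve dotS_gt0 : core.

Lemma stereo_head X P : 1 - (stereo (X, P)).1 0 0 = 2 / (dot X X + 1).
Proof. by rewrite stereoE cons_row0; field; rewrite gt_eqF. Qed.

Lemma stereo_head_neq1 X P : (stereo (X, P)).1 0 0 != 1.
Proof. by rewrite eq_sym -subr_eq0 stereo_head mulf_neq0// invr_neq0// gt_eqF. Qed.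

Lemma stereo_cotangent w : @cotangent_sphere R n (stereo w).
Proof.
case: w => X P; apply/cotangent_sphereP; rewrite stereoE/= !dot_cons.
rewrite !(dotZl, dotZr, dotDr, dotNr); split; field; by rewrite gt_eqF.
Qed.

(** Conformality of the stereographic projection: covectors are stretched by the inverse of the
    conformal factor 2 / (|X|^2 + 1). *)
Lemma stereo_dot2 X P :
  dot (stereo (X, P)).2 (stereo (X, P)).2 = ((dot X X + 1) / 2) ^+ 2 * dot P P.
Proof.
rewrite stereoE/= dot_cons !(dotZl, dotZr, dotDr, dotDl, dotNr, dotNl) (dotC P X).
by field.
Qed.

Lemma stereoK : cancel (@stereo R n) (@unstereo n).
Proof.
move=> [X P]; rewrite /unstereo stereo_head !stereoE /= !cons_rowK !cons_row0.
have X0 : dot X X + 1 != 0 by rewrite gt_eqF.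
by congr (_, _); apply/rowP => i; rewrite !mxE; field.
Qed.

Lemma unstereoK w : @cotangent_sphere R n w -> w.1 0 0 != 1 ->
  stereo (unstereo w) = w.
Proof.
suff K : forall u v : 'rV[R]_n.+1, dot u u = 1 -> dot u v = 0 -> u 0 0 != 1 ->
    stereo (unstereo (u, v)) = (u, v).
  by case: w => u v /cotangent_sphereP[uu uv]; exact: K.
move=> u v; rewrite -(tail_rowK u) -(tail_rowK v); move: (u 0 0) (tail_row u) (v 0 0) (tail_row v).
move=> {w u v} x u y v; rewrite !dot_cons cons_row0 => uu uv x1.
have x10 : 1 - x != 0 by rewrite subr_eq0 eq_sym.
have -> : unstereo (cons_row x u, cons_row y v) =
    ((1 - x)^-1 *: u, (1 - x) *: v + y *: u).
  by rewrite /unstereo /= !cons_row0 !cons_rowK.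
rewrite stereoE !(dotZl, dotZr, dotDr).
have uuE : dot u u = 1 - x * x by rewrite -uu addrAC subrr add0r.
have uvE : dot u v = - (x * y) by apply/eqP; rewrite -addr_eq0 addrC uv.
have s1 : (1 - x)^-1 * ((1 - x)^-1 * dot u u) + 1 = 2 / (1 - x).
  by rewrite uuE; field.
have s2 : (1 - x)^-1 * ((1 - x)^-1 * dot u u) - 1 = 2 * x / (1 - x).
  by rewrite uuE; field.
have -> : (1 - x)^-1 * ((1 - x) * dot u v + y * dot u u) = y.
  by rewrite uuE uvE; field.
rewrite s1 s2; congr (_, _); congr cons_row.
- by field.
- by rewrite scalerA; apply/rowP => i; rewrite !mxE; field.
- by apply/rowP => i; rewrite !mxE; field.
Qed.

End Stereo.
End Dot.

Section SmoothRows.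
Context {R : realType} {V : normedModType R} (U : set V) (oU : open U).

Lemma smooth_open_dot n (f g : V -> 'rV[R]_n) : smooth_open U f -> smooth_open U g ->
  smooth_open U (fun x => dot (f x) (g x) : R^o).
Proof using oU.
move=> sf sg; apply: smooth_open_sum => // i.
by apply: smooth_openM => //; exact: smooth_open_coord.
Qed.

Lemma smooth_open_tail n (f : V -> 'rV[R]_n.+1) : smooth_open U f ->
  smooth_open U (fun x => tail_row (f x)).
Proof using oU.
move=> sf; apply: smooth_open_row => // i.
by apply: smooth_open_ext (smooth_open_coord oU (rshift 1 i) sf) => // x _; rewrite mxE.
Qed.

Lemma smooth_open_cons n (f : V -> R^o) (g : V -> 'rV[R]_n) :
  smooth_open U f -> smooth_open U g -> smooth_open U (fun x => cons_row (f x) (g x)).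
Proof using oU.
move=> sf sg; apply: smooth_open_row => // i.
case E : (fintype.split (i : 'I_(1 + n))) => [j|j].
  by apply: (smooth_open_ext oU _ sf) => x _; rewrite mxE E mxE.
by apply: (smooth_open_ext oU _ (smooth_open_coord oU j sg)) => x _; rewrite mxE E.
Qed.

Lemma smooth_open_stereo n (f : V -> 'rV[R]_n * 'rV[R]_n) : smooth_open U f ->
  smooth_open U (fun x => stereo (f x)).
Proof using oU.
move=> sf; have s1 := smooth_open_fst oU sf; have s2 := smooth_open_snd oU sf.
have sd := smooth_open_dot s1 s1; have sd' := smooth_open_dot s1 s2.
have c (a : R^o) := smooth_open_cst oU a.
have sD := smooth_openD oU sd (c 1).
have sV : smooth_open U (fun x => (dot (f x).1 (f x).1 + 1)^-1 : R^o).
  by apply: smooth_openV sD => // x _; rewrite gt_eqF// dotS_gt0.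
apply: (smooth_open_ext oU (f := fun x =>
  (cons_row ((dot (f x).1 (f x).1 - 1) / (dot (f x).1 (f x).1 + 1))
    ((2 / (dot (f x).1 (f x).1 + 1)) *: (f x).1),
   cons_row (dot (f x).1 (f x).2)
    (((dot (f x).1 (f x).1 + 1) / 2) *: (f x).2 - dot (f x).1 (f x).2 *: (f x).1)))).
  by move=> x _; case: (f x).
apply: smooth_open_pair => //; apply: smooth_open_cons.
- by apply: smooth_openM => //; exact: smooth_openD.
- by apply: smooth_openZ => //; apply: smooth_openM.
- by [].
- apply: smooth_openD => //; first by apply: smooth_openZ => //; exact: smooth_openM.
  by apply: smooth_openN => //; exact: smooth_openZ.
Qed.

Lemma smooth_open_unstereo n (f : V -> 'rV[R]_n.+1 * 'rV[R]_n.+1) :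
  (forall x, U x -> (f x).1 0 0 != 1) -> smooth_open U f ->
  smooth_open U (fun x => unstereo (f x)).
Proof using oU.
move=> f1 sf; have s1 := smooth_open_fst oU sf; have s2 := smooth_open_snd oU sf.
have c (a : R^o) := smooth_open_cst oU a.
have t1 := smooth_open_tail s1; have t2 := smooth_open_tail s2.
have h1 := smooth_open_coord oU 0 s1; have h2 := smooth_open_coord oU 0 s2.
have hD := smooth_openD oU (c 1) (smooth_openN oU h1).
apply: smooth_open_pair => //.
  apply: smooth_openZ => //; apply: smooth_openV => // x /f1.
  by rewrite subr_eq0 eq_sym.
by apply: smooth_openD => //; exact: smooth_openZ.
Qed.

End SmoothRows.

(** * Submanifolds *)

Section Submanifolds.
Context {R : realType}.
Implicit Types V W Z : normedModType R.


Lemma smooth_on_open_continuous V W (A : set V) (f : V -> W) :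
  open A -> smooth_on A f -> forall x, A x -> {for x, continuous f}.
Proof.
move=> oA sf x Ax; have [U [F [oU Ux sF FA]]] := sf x Ax.
apply: (smooth_open_continuous (U := A `&` U)) => //.
apply: (@smooth_open_ext _ _ _ (openI oA oU) _ F); first by move=> y [/FA].
by apply: smooth_openW sF => y [].
Qed.

Lemma smooth_on_pair V W Z (A : set V) (f : V -> W) (g : V -> Z) :
  smooth_on A f -> smooth_on A g -> smooth_on A (fun x => (f x, g x)).
Proof.
move=> sf sg x Ax; have [U [F [oU Ux sF FA]]] := sf x Ax.
have [U' [G [oU' Ux' sG GA]]] := sg x Ax.
have oI := openI oU oU'.
exists (U `&` U'), (fun x => (F x, G x)); split => //.
  by apply: smooth_open_pair => //; [apply: smooth_openW sF|apply: smooth_openW sG] => y [].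
by move=> y Ay [Uy Uy']; rewrite FA// GA.
Qed.

Lemma submanifold_diffeo V W k (M : set V) (N : set W) f g :
  fin_dim V -> fin_dim W -> diffeo M N f g -> submanifold k N -> submanifold k M.
Proof.
move=> dV dW [[fM gN] gf fg sf sg] sN x Mx.
have [U [Om [phi [psi [oU Ufx oO [[phiO psiN] psiphi phipsi sphi spsi]]]]]] := sN _ (fM _ Mx).
have [U1 [F [oU1 U1x sF FM]]] := sf x Mx.
have sgphi : smooth_on Om (g \o phi).
  apply: (smooth_on_comp dW (B := N)) => // y Oy; first by have [] := phiO y Oy.
(* The chart is cut down to where its image lies in [U1], on which [F] extends [f]. *)
have oO' := open_preimage_on oO (smooth_on_open_continuous oO sgphi) oU1.
have oU' := open_preimage_on oU1 (smooth_open_continuous sF) oU.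
exists (U1 `&` F @^-1` U), (Om `&` (g \o phi) @^-1` U1), (g \o phi), (psi \o f).
have subO y : Om y -> M (g (phi y)) by move=> Oy; apply: gN; have [] := phiO y Oy.
have subM y : M y -> U1 y -> U (F y) -> Om (psi (f y)).
  by move=> My U1y; rewrite /= FM// => Ufy; apply: psiN; split=> //; exact: fM.
have fgphi y : Om y -> f (g (phi y)) = phi y by move=> Oy; rewrite fg//; have [] := phiO y Oy.
have phipsif y : M y -> U1 y -> U (F y) -> g (phi (psi (f y))) = y.
  by move=> My U1y; rewrite FM// => Ufy; rewrite phipsi ?gf//; split=> //; exact: fM.
split => //; first by split => //=; rewrite FM.
split.
- split=> [y [Oy U1y]|y [My [U1y UFy]]].
    split; [exact: subO|split => //=]; rewrite FM//; last exact: subO.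
    by rewrite fgphi//; have [] := phiO y Oy.
  by split => /=; [exact: subM|rewrite phipsif].
- by move=> y [Oy _] /=; rewrite fgphi// psiphi.
- by move=> y [My [U1y UFy]] /=; exact: phipsif.
- by apply: smooth_on_sub sgphi => y [].
- apply: (smooth_on_comp dW (B := N `&` U)) => //.
    by move=> y [My [U1y /=]]; rewrite FM// => ?; split => //; exact: fM.
  by apply: smooth_on_sub sf => y [].
Qed.

Lemma submanifold_local V k (M : set V) :
  (forall x, M x -> exists U, [/\ open U, U x & submanifold k (M `&` U)]) ->
  submanifold k M.
Proof.
move=> loc x Mx; have [U [oU Ux sM]] := loc x Mx.
have [U' [Om [phi [psi [oU' Ux' oO D]]]]] := sM x (conj Mx Ux).
exists (U `&` U'), Om, phi, psi; split => //; first exact: openI.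
by rewrite setIA.
Qed.

Lemma submanifold_setT k : submanifold k [set: 'rV[R]_k].
Proof.
move=> x _; exists setT, setT, id, id; split => //; [exact: openT|exact: openT|].
have sid : smooth_on setT (@id 'rV[R]_k).
  by apply: (smooth_open_on openT) => //; exact: (smooth_open_id openT).
by rewrite setTI; split.
Qed.

Lemma submanifold_setTX W j k (M : set W) :
  fin_dim W -> submanifold k M -> submanifold (j + k) ([set: 'rV[R]_j] `*` M).
Proof.
move=> dW sM [a b] [_ /= Mb].
have [U [Om [phi [psi [oU Ub oO [[phiO psiN] psiphi phipsi sphi spsi]]]]]] := sM _ Mb.
have sl : smooth_open setT (fun z : 'rV[R]_(j + k) => lsubmx z).
  apply: (smooth_open_row openT) => i.
  apply: (smooth_open_ext openT _ (smooth_open_coord openT (lshift k i) (smooth_open_id openT))).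
  by move=> z _; rewrite mxE.
have sr : smooth_open setT (fun z : 'rV[R]_(j + k) => rsubmx z).
  apply: (smooth_open_row openT) => i.
  apply: (smooth_open_ext openT _ (smooth_open_coord openT (rshift j i) (smooth_open_id openT))).
  by move=> z _; rewrite mxE.
have srow : smooth_open setT (fun p : 'rV[R]_j * 'rV[R]_k => row_mx p.1 p.2).
  have s1 := smooth_open_fst openT (smooth_open_id (@openT ('rV[R]_j * 'rV[R]_k)%type)).
  have s2 := smooth_open_snd openT (smooth_open_id (@openT ('rV[R]_j * 'rV[R]_k)%type)).
  apply: (smooth_open_row openT) => i.
  case E : (fintype.split i) => [l|l].
    by apply: (smooth_open_ext openT _ (smooth_open_coord openT l s1)) => z _; rewrite mxE E.
  by apply: (smooth_open_ext openT _ (smooth_open_coord openT l s2)) => z _; rewrite mxE E.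
exists ([set: 'rV[R]_j] `*` U), ([set z | Om (rsubmx z)]),
  (fun z => (lsubmx z, phi (rsubmx z))), (fun p => row_mx p.1 (psi p.2)).
have -> : (setT `*` M) `&` (setT `*` U) = [set: 'rV[R]_j] `*` (M `&` U).
  by apply/seteqP; split => [[u v] [[/= _ ?] [_ ?]]//|[u v] [/= _ []]].
split => //.
- rewrite (_ : _ `*` _ = snd @^-1` U); last by apply/seteqP; split => [z []|z].
  by apply: open_comp => // z _; exact: cvg_snd.
- have := open_preimage_on openT (smooth_open_continuous sr) oO. by rewrite setTI.
split.
- split=> [z Oz|[u v] [_ Mv]]; first by split => //; exact: phiO.
  by rewrite /= row_mxKr; exact: psiN.
- by move=> z Oz /=; rewrite psiphi// hsubmxK.
- by move=> [u v] [_ /= MUv]; rewrite row_mxKl row_mxKr phipsi.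
- apply: smooth_on_pair; first by apply: (smooth_open_on openT) sl.
  apply: (smooth_on_comp (fin_dim_rV k) (B := Om)) sphi => //.
  by apply: (smooth_open_on openT) sr.
- apply: (smooth_on_comp (fin_dim_prod (fin_dim_rV j) (fin_dim_rV k)) (B := setT)
    (f := fun p => (p.1, psi p.2)) (g := fun p => row_mx p.1 p.2)) => //.
    have s1 := smooth_open_fst openT (smooth_open_id (@openT ('rV[R]_j * W)%type)).
    have s2 := smooth_open_snd openT (smooth_open_id (@openT ('rV[R]_j * W)%type)).
    apply: smooth_on_pair; first by apply: (smooth_open_on openT) s1.
    apply: (smooth_on_comp dW (B := M `&` U) (f := snd)) spsi; first by move=> [u v] [].
    by apply: (smooth_open_on openT) s2.
  by apply: (smooth_open_on openT) srow.
Qed.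

(** Carries charts off one pole to charts around it, through an ambient symmetry of [M]. *)
Lemma submanifold_reflection V k (M U : set V) (f : V -> V) :
  fin_dim V -> smooth_open setT f -> involutive f -> (forall x, M x -> M (f x)) ->
  submanifold k (M `&` U) -> submanifold k (M `&` f @^-1` U).
Proof.
move=> dV sf fK fM; apply: (submanifold_diffeo (f := f) (g := f)) => //.
split.
- split=> x [Mx Ux]; first by split => //; exact: fM.
  by split; [exact: fM|rewrite /= fK].
- by move=> x _; exact: fK.
- by move=> x _; exact: fK.
- exact: (smooth_open_on openT).
- exact: (smooth_open_on openT).
Qed.

Lemma open_smooth_neq V (h : V -> R^o) a :
  smooth_open setT h -> open [set x | h x != a].
Proof.
move=> sh; have := open_preimage_on openT (smooth_open_continuous sh) (@open_neq R a).
by rewrite setTI.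
Qed.

Lemma smooth_open_idT V : smooth_open setT (@id V).
Proof. exact: (smooth_open_id openT). Qed.

Definition unit_sphere k : set 'rV[R]_k.+1 := [set x | dot x x = 1].

(** The reflection exchanging the two poles. *)
Definition flip k (u : 'rV[R]_k.+1) := cons_row (- u 0 0) (tail_row u).

Lemma flip0 k (u : 'rV[R]_k.+1) : flip u 0 0 = - u 0 0.
Proof. exact: cons_row0. Qed.

Lemma flipK k : involutive (@flip k).
Proof. by move=> u; rewrite /flip cons_row0 cons_rowK opprK tail_rowK. Qed.

Lemma dot_flip k (u v : 'rV[R]_k.+1) : dot (flip u) (flip v) = dot u v.
Proof. by rewrite dot_cons mulrNN -dot_cons !tail_rowK. Qed.

Lemma smooth_open_flip V (U : set V) k (f : V -> 'rV[R]_k.+1) : open U ->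
  smooth_open U f -> smooth_open U (fun x => flip (f x)).
Proof.
move=> oU sf; apply: smooth_open_cons => //; last exact: smooth_open_tail.
by apply: smooth_openN => //; exact: smooth_open_coord.
Qed.

(** The sphere is charted as the zero section, so that the cotangent stereographic projection and
    its inverse serve again with covector 0. *)
Lemma submanifold_punctured_sphere k :
  submanifold k (@unit_sphere k `&` [set x | x 0 0 != 1]).
Proof.
have oU := open_smooth_neq 1 (smooth_open_coord openT 0 (@smooth_open_idT 'rV[R]_k.+1)).
have sp : smooth_open [set x : 'rV[R]_k.+1 | x 0 0 != 1] (fun x => (unstereo (x, 0)).1).
  apply: (smooth_open_fst oU); apply: (smooth_open_unstereo oU) => //.
  by apply: (smooth_open_pair oU); [exact: (smooth_open_id oU)|exact: (smooth_open_cst oU)].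
have ss : smooth_open setT (fun y : 'rV[R]_k => (stereo (y, 0)).1).
  apply: (smooth_open_fst openT); apply: (smooth_open_stereo openT).
  by apply: (smooth_open_pair openT); [exact: (smooth_open_id openT)|
    exact: (smooth_open_cst openT)].
have cot (x : 'rV[R]_k.+1) : unit_sphere x -> cotangent_sphere (x, 0).
  by move=> xx; apply/cotangent_sphereP; rewrite dot0r.
apply: (submanifold_diffeo (fin_dim_rV _) (fin_dim_rV k)
  (f := fun x => (unstereo (x, 0)).1) (g := fun y => (stereo (y, 0)).1)
  (N := setT)); last exact: submanifold_setT.
split.
- split => // y _; split; last exact: stereo_head_neq1.
  by have /cotangent_sphereP[] := stereo_cotangent (y, 0).
- move=> x [/cot xC x1]; have <- : (unstereo (x, 0)).2 = 0.
    by apply/rowP => i; rewrite !mxE mulr0 mul0r addr0.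
  by rewrite -surjective_pairing unstereoK.
- move=> y _; have -> : ((stereo (y, 0)).1, 0) = stereo (y, 0) :> ('rV[R]_k.+1 * 'rV[R]_k.+1).
    rewrite [RHS]surjective_pairing; congr pair.
    by rewrite stereoE /= dot0r scaler0 scale0r subr0
      -(scale0r (cons_row 0 0)) scale_cons mul0r scale0r.
  by rewrite stereoK.
- by apply: (smooth_open_on oU) sp => x [].
- exact: (smooth_open_on openT).
Qed.

Lemma submanifold_unit_sphere k : submanifold k (@unit_sphere k).
Proof.
have s0 := smooth_open_coord openT 0 (@smooth_open_idT 'rV[R]_k.+1).
apply: submanifold_local => x xx; have [x1|x1] := eqVneq (x 0 0) 1; last first.
  exists [set x : 'rV[R]_k.+1 | x 0 0 != 1]; split => //; first exact: open_smooth_neq.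
  exact: submanifold_punctured_sphere.
have sfl := smooth_open_flip openT (@smooth_open_idT 'rV[R]_k.+1).
exists [set x : 'rV[R]_k.+1 | flip x 0 0 != 1]; split.
- by apply: open_smooth_neq; exact: (smooth_open_coord openT).
- by rewrite /= flip0 x1 eq_sym -addr_eq0 -mulr2n pnatr_eq0.
- apply: (submanifold_reflection (fin_dim_rV _) sfl) (@submanifold_punctured_sphere k).
  + exact: flipK.
  + by move=> y; rewrite /unit_sphere /= dot_flip.
Qed.

(** Rescaling by the conformal factor turns unit covectors on the sphere into Euclidean unit
    vectors, whence a trivialization by R^(m+1) x S^m, of dimension (m + 1) + m. *)
Lemma submanifold_punctured_unit_cotangent m :
  submanifold (m.+1 + m) (@unit_cotangent_sphere R m.+1 `&`
    [set w : 'rV[R]_m.+2 * 'rV[R]_m.+2 | w.1 0 0 != 1]).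
Proof.
pose VV := ('rV[R]_m.+2 * 'rV[R]_m.+2)%type; pose W := ('rV[R]_m.+1 * 'rV[R]_m.+1)%type.
have oU := open_smooth_neq 1
  (smooth_open_coord openT 0 (smooth_open_fst openT (@smooth_open_idT VV))).
pose f (w : VV) : W := let z := unstereo w in (z.1, ((dot z.1 z.1 + 1) / 2) *: z.2).
pose g (z : W) : VV := stereo (z.1, (2 / (dot z.1 z.1 + 1)) *: z.2).
have s1 := smooth_open_fst openT (@smooth_open_idT W).
have s2 := smooth_open_snd openT (@smooth_open_idT W).
have ss := smooth_openD openT (smooth_open_dot openT s1 s1) (smooth_open_cst openT (1 : R^o)).
have sg : smooth_open setT g.
  apply: (smooth_open_stereo openT); apply: (smooth_open_pair openT) => //.
  apply: (smooth_openZ openT) => //; apply: (smooth_openM openT) => //.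
    exact: (smooth_open_cst openT).
  by apply: (smooth_openV openT) => // z _; rewrite gt_eqF// dotS_gt0.
have sf : smooth_open [set w : VV | w.1 0 0 != 1] f.
  have su := smooth_open_unstereo oU (fun w Hw => Hw) (smooth_open_id oU).
  have su1 := smooth_open_fst oU su; have su2 := smooth_open_snd oU su.
  apply: (smooth_open_pair oU) => //; apply: (smooth_openZ oU) => //.
  apply: (smooth_openM oU); last exact: (smooth_open_cst oU).
  apply: (smooth_openD oU); last exact: (smooth_open_cst oU).
  exact: (smooth_open_dot oU).
apply: (submanifold_diffeo (fin_dim_prod (fin_dim_rV _) (fin_dim_rV _))
   (fin_dim_prod (fin_dim_rV _) (fin_dim_rV _)) (f := f) (g := g)
   (N := setT `*` @unit_sphere m)); last first.
  by apply: submanifold_setTX; [exact: fin_dim_rV|exact: submanifold_unit_sphere].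
have UTP (w : VV) : unit_cotangent_sphere w -> w.1 0 0 != 1 ->
    stereo (unstereo w) = w /\
    ((dot (unstereo w).1 (unstereo w).1 + 1) / 2) ^+ 2 *
      dot (unstereo w).2 (unstereo w).2 = 1.
  move=> /[dup] wU [wC _] w1; split; first exact: unstereoK.
  rewrite -stereo_dot2 -surjective_pairing unstereoK//.
  by have /unit_cotangent_sphereP[] := wU.
have cancel1 (s : R) : s != 0 -> 2 / s * (s / 2) = 1 by move=> s0; field.
have dS (X : 'rV[R]_m.+1) : dot X X + 1 != 0 by rewrite gt_eqF// dotS_gt0.
split.
- split=> [w [wU w1]|[X u] [_ uu]].
    by split => //; have [_ E] := UTP w wU w1; rewrite /unit_sphere /= dotZl dotZr mulrA -expr2.
  split; last exact: stereo_head_neq1.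
  split; first exact: stereo_cotangent.
  apply/enorm_eq1; rewrite stereo_dot2 dotZl dotZr /= uu.
  by field; rewrite dS.
- move=> w [wU w1]; transitivity (stereo (unstereo w)).
    have gfE (z : W) : stereo (z.1, (2 / (dot z.1 z.1 + 1)) *:
        (((dot z.1 z.1 + 1) / 2) *: z.2)) = stereo z.
      by rewrite scalerA cancel1// scale1r -surjective_pairing.
    exact: (gfE (unstereo w)).
  by have [] := UTP w wU w1.
- move=> [X u] _; rewrite /f /g stereoK /= scalerA.
  by rewrite mulrC cancel1 ?scale1r.
- by apply: (smooth_open_on oU) sf => x [].
- exact: (smooth_open_on openT).
Qed.

Lemma submanifold_unit_cotangent_sphere m :
  submanifold (m.+1 + m) (@unit_cotangent_sphere R m.+1).
Proof.
pose VV := ('rV[R]_m.+2 * 'rV[R]_m.+2)%type.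
have s1 := smooth_open_fst openT (@smooth_open_idT VV).
have s2 := smooth_open_snd openT (@smooth_open_idT VV).
apply: submanifold_local => w wU; have [w1|w1] := eqVneq (w.1 0 0) 1; last first.
  exists [set w : VV | w.1 0 0 != 1]; split => //.
    by apply: open_smooth_neq; exact: (smooth_open_coord openT).
  exact: submanifold_punctured_unit_cotangent.
have sfl := smooth_open_pair openT (smooth_open_flip openT s1) (smooth_open_flip openT s2).
exists [set w : VV | flip w.1 0 0 != 1]; split.
- apply: open_smooth_neq; apply: (smooth_open_coord openT).
  exact: (smooth_open_flip openT).
- by rewrite /= flip0 w1 eq_sym -addr_eq0 -mulr2n pnatr_eq0.
- apply: (submanifold_reflection (fin_dim_prod (fin_dim_rV _) (fin_dim_rV _)) sfl)
    (@submanifold_punctured_unit_cotangent m).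
  + by move=> [u v] /=; rewrite !flipK.
  + by move=> y /unit_cotangent_sphereP yU; apply/unit_cotangent_sphereP; rewrite !dot_flip.
Qed.
End Submanifolds.

(** * Tangent vectors *)

Section Tangent.
Context {R : realType}.
Implicit Types V W Z : normedModType R.

Lemma diff_linear_fun V W (L : V -> W) x : linear L -> continuous L ->
  'd L x = L :> (V -> W).
Proof.
move=> linL cL; pose LM := GRing.isLinear.Build _ _ _ _ _ linL.
pose L' : {linear V -> W} := HB.pack L LM.
exact: (diff_lin x (f := L')).
Qed.

Lemma tangent_image V W (M : set V) (N : set W) (f : V -> W) x v U F :
  fin_dim V -> (forall y, M y -> N (f y)) -> tangent M x v ->
  smooth_extension M f x U F -> tangent N (f x) ('d F x v).
Proof.
move=> dV fMN [I [gam [oI I0 sgam gamM [gam0 dgam]]]] [oU Ux sF FM].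
have oI' := open_preimage_on oI (smooth_open_continuous sgam) oU.
exists (I `&` gam @^-1` U), (F \o gam); split => //.
- by split => //=; rewrite gam0.
- apply: (smooth_open_comp dV oI' oU) sF => [t []//|k].
  by apply: Ck_openW (sgam k) => t [].
- by move=> t [It Ut] /=; rewrite FM//; [apply: fMN|]; exact: gamM.
- have Mx : M x by rewrite -gam0; exact: gamM.
  split; first by rewrite /= gam0 FM.
  have dg : differentiable gam 0 by exact: smooth_open_differentiable sgam 0 I0.
  have dF : differentiable F (gam 0).
    by rewrite gam0; exact: smooth_open_differentiable sF x Ux.
  by rewrite (diff_comp dg dF) /= dgam gam0.
Qed.

(** Both maps agree along a curve of M with velocity v, and the chain rule reads the differential
    off that curve. Hence the choice of smooth extension does not matter. *)
Lemma tangent_diff_eq V W (M U : set V) (F G : V -> W) x v :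
  tangent M x v -> open U -> U x -> (forall y, M y -> U y -> F y = G y) ->
  differentiable F x -> differentiable G x -> 'd F x v = 'd G x v.
Proof.
move=> [I [gam [oI I0 sgam gamM [gam0 <-]]]] oU Ux FG dF dG.
have dg : differentiable gam 0 by exact: smooth_open_differentiable sgam 0 I0.
rewrite -gam0 in dF dG *.
have := diff_comp dg dF; have := diff_comp dg dG => eG eF.
transitivity ('d (F \o gam) 0 1); first by rewrite eF.
transitivity ('d (G \o gam) 0 1); last by rewrite eG.
have oI' := open_preimage_on oI (smooth_open_continuous sgam) oU.
have I'0 : (I `&` gam @^-1` U) 0 by split => //=; rewrite gam0.
have FGgam t : (I `&` gam @^-1` U) t -> (F \o gam) t = (G \o gam) t.
  by move=> [It Ut] /=; apply: FG => //; exact: gamM.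
by have [_ ->] := open_eq_is_diff oI' I'0 FGgam (differentiable_comp dg dF).
Qed.

(** B is the velocity of a rotating curve. The circle is parametrized by ((4 - t^2) / (4 + t^2), 4 t
    / (4 + t^2)), which has unit speed at t = 0 and whose smoothness is purely algebraic. *)
Lemma tangent_rotation V (N : set V) y A B :
  (forall c s : R, c ^+ 2 + s ^+ 2 = 1 -> N (y + (c - 1) *: A + s *: B)) ->
  tangent N y B.
Proof.
move=> rotN.
have q0 (t : R) : 4 + t ^+ 2 != 0 by rewrite gt_eqF// ltr_pwDl// sqr_ge0.
(* A factor t is split off, c - 1 = t b1 and s = t b2, so that the derivatives at 0 are simply b1 0
   = 0 and b2 0 = 1. *)
pose b1 (t : R^o) : R^o := - 2 * t / (4 + t ^+ 2).
pose b2 (t : R^o) : R^o := 4 / (4 + t ^+ 2).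
have sid := smooth_open_id (@openT R^o).
have scst (a : R^o) := smooth_open_cst (@openT R^o) a.
have sq : smooth_open setT (fun t : R^o => (4 + t ^+ 2)^-1 : R^o).
  apply: (smooth_openV openT) => [t _|]; first exact: q0.
  by apply: (smooth_openD openT) => //; exact: (smooth_openX openT).
have sb1 : smooth_open setT b1.
  by apply: (smooth_openM openT) => //; exact: (smooth_openM openT).
have sb2 : smooth_open setT b2 by exact: (smooth_openM openT).
have db (b : R^o -> R^o) : smooth_open setT b ->
    is_diff (0 : R^o) (fun t : R^o => t * b t : R^o) (fun v : R^o => v * b 0 : R^o).
  move=> sb; apply: (is_diff_mul_vanishing (a := id)) => //.
  exact: (smooth_open_continuous sb).
pose gam (t : R^o) : V := y + (t * b1 t) *: A + (t * b2 t) *: B.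
exists setT, gam; split => //.
- exact: openT.
- apply: (smooth_openD openT); first apply: (smooth_openD openT).
  + exact: (smooth_open_cst openT).
  + apply: (smooth_openZ openT); last exact: (smooth_open_cst openT).
    exact: (smooth_openM openT).
  + apply: (smooth_openZ openT); last exact: (smooth_open_cst openT).
    exact: (smooth_openM openT).
- move=> t _; rewrite /gam.
  have -> : t * b1 t = (4 - t ^+ 2) / (4 + t ^+ 2) - 1 by rewrite /b1; field; exact: q0.
  apply: rotN; rewrite /b2; field; exact: q0.
- split; first by rewrite /gam !mul0r !scale0r !addr0.
  have dZ (b : R^o -> R^o) (C : V) : smooth_open setT b ->
      is_diff (0 : R^o) (fun t : R^o => (t * b t : R^o) *: C)
        (fun v : R^o => (v * b 0 : R^o) *: C).
    move=> /db[d e]; apply: is_diff_eq (is_diff_scale d (differentiable_cst C _)) _.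
    apply/funext => v; rewrite mul0r scale0r add0r; congr (_ *: _).
    exact: (congr1 (fun h : R^o -> R^o => h v) e).
  have [_ e] := is_diffD (is_diffD (is_diff_cst y (0 : R^o)) (dZ b1 A sb1)) (dZ b2 B sb2).
  apply: (etrans (congr1 (fun h : R^o -> V => h 1) e)).
  have b10 : b1 0 = 0 by rewrite /b1 mulr0 mul0r.
  have b20 : b2 0 = 1 by rewrite /b2 expr0n addr0 divff// pnatr_eq0.
  rewrite -[LHS]/(0 + (1 * b1 0 : R^o) *: A + (1 * b2 0 : R^o) *: B).
  by rewrite b10 b20 mulr0 mulr1 scale0r scale1r !add0r.
Qed.

End Tangent.

(** * Fibrewise star-shaped hypersurfaces *)

Section StarShaped.
Context {R : realType}.
Variable m : nat.
Let VV := ('rV[R]_m.+2 * 'rV[R]_m.+2)%type.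
Let S : set VV := @unit_cotangent_sphere R m.+1.

Definition fibre_scale (rho : VV -> R^o) (w : VV) : VV := (w.1, rho w *: w.2).
Definition fibre_normalize (w : VV) : VV := (w.1, (enorm w.2)^-1 *: w.2).

Lemma fin_dim_VV : fin_dim VV.
Proof. exact: (fin_dim_prod (fin_dim_rV _) (fin_dim_rV _)). Qed.

Lemma smooth_fst (U : set VV) : open U -> smooth_open U (fun w : VV => w.1).
Proof. by move=> oU; exact: (smooth_open_fst oU (smooth_open_id oU)). Qed.

Lemma smooth_snd (U : set VV) : open U -> smooth_open U (fun w : VV => w.2).
Proof. by move=> oU; exact: (smooth_open_snd oU (smooth_open_id oU)). Qed.

Lemma open_nonzero_fibre : open [set w : VV | dot w.2 w.2 != 0].
Proof.
apply: (open_smooth_neq 0); have s2 := smooth_snd openT.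
exact: (smooth_open_dot openT s2 s2).
Qed.

(** 1/|eta| is a continuous simple root of |eta|^2 r^2 = 1, a degenerate cubic, so only continuity
    of the square root enters. *)
Lemma smooth_inv_enorm :
  smooth_open [set w : VV | dot w.2 w.2 != 0] (fun w => (enorm w.2)^-1 : R^o).
Proof.
have oU := open_nonzero_fibre; have s2 := smooth_snd oU.
have sd := smooth_open_dot oU s2 s2.
apply: (smooth_cubic_root oU (smooth_open_cst oU 0) sd (smooth_open_cst oU 0)).
- move=> w /= w0; apply: cvgV; first by rewrite gt_eqF// enorm_gt0 -dot_eq0.
  apply: (@continuous_comp _ _ _ (fun w : VV => dot w.2 w.2 : R) (@Num.sqrt R)).
    exact: (smooth_open_continuous sd).
  exact: sqrt_continuous.
- move=> w /= w0; rewrite mul0r mul0r add0r addr0 -sqr_enorm exprVn divff//.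
  by rewrite expf_neq0// gt_eqF// enorm_gt0 -dot_eq0.
- move=> w /= w0; rewrite mulr0 mul0r add0r addr0 !mulf_neq0// invr_neq0//.
  by rewrite gt_eqF// enorm_gt0 -dot_eq0.
Qed.

Lemma smooth_fibre_normalize :
  smooth_open [set w : VV | dot w.2 w.2 != 0] fibre_normalize.
Proof.
have oU := open_nonzero_fibre.
apply: (smooth_open_pair oU); first exact: smooth_fst.
by apply: (smooth_openZ oU); [exact: smooth_inv_enorm|exact: smooth_snd].
Qed.

Lemma compact_unit_cotangent_sphere : compact S.
Proof.
have cB : compact [set u : 'rV[R]_m.+2 | dot u u = 1].
  apply: bounded_closed_compact.
    exists 1; split => // M M1 u /= uu; apply: (le_trans _ (ltW M1)).
    rewrite [leLHS]mx_normrE; apply: bigmax_le => // -[i j] _ /=.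
    rewrite ord1 -(@ler_pXn2r _ 2%N)// ?nnegrE// expr1n real_normK ?num_real// -uu.
    rewrite /dot (bigD1 j)//= expr2 lerDl sumr_ge0// => k _.
    by rewrite -expr2 sqr_ge0.
  have sd := smooth_open_dot openT (smooth_open_id (@openT 'rV[R]_m.+2)) (smooth_open_id openT).
  have := @closed_comp _ _ (fun u : 'rV[R]_m.+2 => dot u u : R) [set x | x = 1].
  by apply; [move=> u _; exact: (smooth_open_continuous sd)|exact: closed_eq].
have s1 := smooth_fst openT; have s2 := smooth_snd openT.
have sd := smooth_open_dot openT s1 s2.
rewrite (_ : S = ([set u | dot u u = 1] `*` [set u | dot u u = 1]) `&`
  (fun w : VV => dot w.1 w.2 : R) @^-1` [set x | x = 0]).
  apply: compact_closedI; first exact: compact_setX.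
  apply: closed_comp; last exact: closed_eq.
  by move=> w _; exact: (smooth_open_continuous sd).
apply/seteqP; split => w; first by move/unit_cotangent_sphereP => [? ? ?]; split.
by move=> [[/= ? ?] ?]; apply/unit_cotangent_sphereP.
Qed.

Variable rho : VV -> R^o.
Hypothesis srho : smooth_on S rho.
Hypothesis rho_gt0 : forall w, S w -> 0 < rho w.
Let M := fibre_scale rho @` S.
Let f := fibre_normalize.
Let g := fibre_scale rho.

Lemma fibre_scaleK w : S w -> f (g w) = w.
Proof using rho_gt0.
move=> /[dup] Sw [_ w2]; rewrite /f /g /fibre_normalize /fibre_scale /=.
have r0 := rho_gt0 Sw.
rewrite enormZ w2 mulr1 gtr0_norm// scalerA mulVf ?gt_eqF// scale1r.
by case: (w).
Qed.

Lemma graph_nonzero x : M x -> dot x.2 x.2 != 0.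
Proof using rho_gt0.
move=> [w Sw <-]; have /unit_cotangent_sphereP[_ _ w2] := Sw.
by rewrite /= dotZl dotZr w2 mulr1 mulf_neq0// gt_eqF// rho_gt0.
Qed.

Lemma smooth_on_fibre_scale : smooth_on S g.
Proof using srho.
move=> w Sw; have [U [F [oU Uw sF FS]]] := srho Sw.
exists U, (fun z => (z.1, F z *: z.2)); split => //.
  apply: (smooth_open_pair oU); first exact: smooth_fst.
  by apply: (smooth_openZ oU) => //; exact: smooth_snd.
by move=> z Sz Uz; rewrite FS.
Qed.

Lemma diffeo_normalize : diffeo M S f g.
Proof using srho rho_gt0.
split.
- split=> [x [w Sw <-]|w Sw]; first by rewrite fibre_scaleK.
  by exists w.
- by move=> x [w Sw <-]; rewrite -/(g w) fibre_scaleK.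
- exact: fibre_scaleK.
- by apply: (smooth_open_on open_nonzero_fibre); [exact: graph_nonzero|
    exact: smooth_fibre_normalize].
- exact: smooth_on_fibre_scale.
Qed.

Lemma compact_graph : compact M.
Proof using srho.
apply: continuous_compact; last exact: compact_unit_cotangent_sphere.
exact: (smooth_on_continuous smooth_on_fibre_scale).
Qed.

Lemma graph_cotangent : M `<=` @cotangent_sphere R m.+1.
Proof.
move=> x [w /unit_cotangent_sphereP[w1 w12 w2] <-]; apply/cotangent_sphereP.
by rewrite /= dotZr w12 mulr0.
Qed.

Lemma submanifold_graph : submanifold (m.*2).+1 M.
Proof using srho rho_gt0.
have -> : (m.*2).+1 = (m.+1 + m)%N by rewrite -addnn.
exact: (submanifold_diffeo fin_dim_VV fin_dim_VV diffeo_normalize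
  (@submanifold_unit_cotangent_sphere R m)).
Qed.

Let linear_fst : linear (fst : VV -> 'rV[R]_m.+2). Proof. by []. Qed.
Let continuous_fst : continuous (fst : VV -> 'rV[R]_m.+2).
Proof. by move=> x; exact: cvg_fst. Qed.

Lemma diff_fst_comp (F : VV -> VV) x v : differentiable F x ->
  differentiable (fst \o F) x /\ ('d F x v).1 = 'd (fst \o F) x v.
Proof.
move=> dF; have d1 : differentiable (fst : VV -> 'rV[R]_m.+2) (F x).
  exact: (smooth_open_differentiable (smooth_fst openT)).
split; first exact: differentiable_comp dF d1.
rewrite (diff_comp dF d1) /=.
exact: (esym (congr1 (@^~ ('d F x v)) (diff_linear_fun (F x) linear_fst continuous_fst))).
Qed.

(** [lambda_can] sees a vector only through its base component, which the differential of a
    fibre-preserving map leaves alone; such a map therefore rescales the form by the ratio of the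
    covectors. *)
Lemma tangent_diff_fst (N : set VV) (h : VV -> VV) x v U F :
  (forall y, N y -> (h y).1 = y.1) -> tangent N x v ->
  smooth_extension N h x U F -> ('d F x v).1 = v.1.
Proof.
move=> h1 tv [oU Ux sF FN].
have dF := smooth_open_differentiable sF Ux.
have [dF1 ->] := diff_fst_comp v dF.
have d1 : differentiable (fst : VV -> 'rV[R]_m.+2) x.
  exact: (smooth_open_differentiable (smooth_fst openT)).
rewrite (tangent_diff_eq (G := fst) tv oU Ux _ dF1 d1).
  exact: (congr1 (@^~ v) (diff_linear_fun x linear_fst continuous_fst)).
by move=> y Ny Uy; rewrite /= FN// h1.
Qed.

Lemma contactomorphic_graph : contactomorphic M (@lambda_can R m.+1)
  (@unit_cotangent_sphere R m.+1) (@lambda_can R m.+1).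
Proof using srho rho_gt0.
have D := diffeo_normalize; have [[fM gS] gf fg sf sg] := D.
exists f, g; split => // x U F Mx FP; have [oU Ux sF FM] := FP.
have x2 : (enorm x.2)^-1 != 0.
  by rewrite invr_neq0// gt_eqF// enorm_gt0 -dot_eq0 graph_nonzero.
apply/seteqP; split=> [_ [v [tv lv] <-]|w [tw lw]].
  split; first exact: (tangent_image fin_dim_VV fM tv FP).
  rewrite /lambda_can (tangent_diff_fst (h := f) _ tv FP)//.
  by rewrite /= dotZl -/(lambda_can x v) lv mulr0.
(* Conversely, [w] comes from its image under the differential of an extension G of the inverse: F o
   G is the identity on the unit cotangent bundle near f x. *)
have Sfx := fM _ Mx.
have [U' [G GP]] := sg _ Sfx; have [oU' Ufx sG GS] := GP.
have Gx : G (f x) = x by rewrite GS// gf.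
have dG := smooth_open_differentiable sG Ufx.
have dF : differentiable F (G (f x)) by rewrite Gx; exact: (smooth_open_differentiable sF Ux).
exists ('d G (f x) w).
  split; first by rewrite -{1}(gf _ Mx); exact: (tangent_image fin_dim_VV gS tw GP).
  rewrite /lambda_can (tangent_diff_fst (h := g) _ tw GP)//.
  move: lw; rewrite /lambda_can /= dotZl => /eqP.
  by rewrite mulf_eq0 (negbTE x2) => /eqP.
transitivity ('d (F \o G) (f x) w).
  have Fx u : 'd F x u = 'd F (G (f x)) u by rewrite Gx.
  have e : 'd (F \o G) (f x) = 'd F (G (f x)) \o 'd G (f x) :> (VV -> VV).
    exact: diff_comp dG dF.
  transitivity ('d F (G (f x)) ('d G (f x) w)); first exact: (Fx ('d G (f x) w)).
  exact: (esym (congr1 (fun h : VV -> VV => h w) e)).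
have oI := open_preimage_on oU' (smooth_open_continuous sG) oU.
transitivity ('d (id : VV -> VV) (f x) w).
  apply: (tangent_diff_eq tw oI) => //.
  - by split => //=; rewrite Gx.
  - move=> y Sy [U'y /=]; rewrite GS// => Uy; rewrite FM ?fg//; exact: gS.
  - exact: differentiable_comp dG dF.
apply: (congr1 (@^~ w) (diff_linear_fun (L := id) (f x) _ _)) => //.
by move=> y; exact: cvg_id.
Qed.

Lemma one_form_lambda_can : one_form (@lambda_can R m.+1).
Proof.
split=> [x a u v|v]; first by rewrite /lambda_can /= dotDr dotZr.
rewrite /lambda_can; apply: (smooth_open_dot openT); first exact: (smooth_snd openT).
exact: (smooth_open_cst openT).
Qed.

Lemma ext_deriv_lambda_can x u v :
  ext_deriv (@lambda_can R m.+1) x u v = dot u.2 v.1 - dot v.2 u.1.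
Proof.
have E (a b : VV) : 'd (fun y => lambda_can y b) x a = dot a.2 b.1.
  apply: (congr1 (@^~ a) (diff_linear_fun (L := fun y => lambda_can y b) x _ _)).
    by move=> k y z; rewrite /lambda_can /= dotDl dotZl.
  by move=> y; apply: (smooth_open_continuous (one_form_lambda_can.2 b)).
by rewrite /ext_deriv !E.
Qed.

(** Differentiating rho adds a radial term. Its coefficient [k] is left unspecified because it drops
    out of the contact volume. *)
Lemma graph_tangent w B : S w -> tangent S w B ->
  exists k : R, tangent M (g w) (B.1, rho w *: B.2 + k *: w.2).
Proof using srho rho_gt0.
move=> Sw tB; have [_ gS] := (diffeo_normalize).
have [U [F [oU Uw sF FS]]] := srho Sw.
have GP : smooth_extension S g w U (fun z => (z.1, F z *: z.2)).
  split => //; last by move=> z Sz Uz; rewrite FS.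
  apply: (smooth_open_pair oU); first exact: smooth_fst.
  by apply: (smooth_openZ oU) => //; exact: smooth_snd.
exists ('d F w B).
have := tangent_image fin_dim_VV _ tB GP (N := M).
move=> /(_ (fun y Sy => ex_intro2 _ _ y Sy erefl)).
have dF := smooth_open_differentiable sF Uw.
have d1 : is_diff w (fst : VV -> 'rV[R]_m.+2) fst.
  split; first exact: (smooth_open_differentiable (smooth_fst openT)).
  exact: diff_linear_fun linear_fst continuous_fst.
have d2 : is_diff w (snd : VV -> 'rV[R]_m.+2) snd.
  split; first exact: (smooth_open_differentiable (smooth_snd openT)).
  by apply: diff_linear_fun => // x; exact: cvg_snd.
have [_ e] := is_diff_pair d1 (is_diff_scale dF (ex_diff (is_diff_def := d2))).
have -> : 'd (fun z => (z.1, F z *: z.2)) w B = (B.1, rho w *: B.2 + 'd F w B *: w.2).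
  apply: (etrans (congr1 (@^~ B) e)) => /=; rewrite FS//.
  congr (_, _ + _); congr (_ *: _); exact: (congr1 (@^~ B) (diff_val (is_diff_def := d2))).
by [].
Qed.

End StarShaped.

(** * Signs of the terms of the contact volume *)

Section ContactVolume.
Context {R : realType}.

(** Matrix of the standard symplectic form for the couples (1, 2), (3, 4), ...; index 0 pairs with
    nothing. *)
Definition symplectic_pairing (i j : nat) : R :=
  (odd i && (j == i.+1))%:R - (odd j && (i == j.+1))%:R.

Section Volume.
Context {V : normedModType R} (n : nat) (alpha : V -> V -> R^o) (x : V).
Variables (v : 'I_(n.*2).+1 -> V) (a r : R).
Hypothesis alphaE : forall i, alpha x (v i) = if i == 0 :> nat then a else 0.
Hypothesis dalphaE : forall i j : 'I_(n.*2).+1, i != 0 :> nat -> j != 0 :> nat ->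
  ext_deriv alpha x (v i) (v j) = r * symplectic_pairing i j.

(** One term of the alternating sum, normalized to a = r = 1. *)
Definition volume_sign (s : 'S_(n.*2).+1) : R := (s ord0 == 0 :> nat)%:R * (-1) ^+ s *
  \prod_(i < n) symplectic_pairing (s (inord (i.*2).+1)) (s (inord (i.*2).+2)).

Lemma contact_volumeE :
  contact_volume alpha x v = a * r ^+ n * \sum_s volume_sign s.
Proof using alphaE dalphaE.
rewrite mulr_sumr; apply: eq_bigr => s _; rewrite /volume_sign alphaE.
case: eqP => s0; last by rewrite mulr0 !mul0r mulr0.
have s0' : s ord0 = ord0 by exact: val_inj.
(* A permutation fixing 0 sends the other slots to nonzero indices, where the symplectic values are
   known. *)
have sn0 k : (0 < k < (n.*2).+1)%N -> s (inord k) != 0 :> nat.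
  move=> /andP[k0 kn]; apply/eqP => sk; have : s (inord k) = s ord0 by rewrite s0'; exact: val_inj.
  by move/perm_inj/(congr1 val); rewrite /= inordK// => k0'; rewrite k0' in k0.
rewrite mul1r (eq_bigr (fun i : 'I_n => r * symplectic_pairing
   (s (inord (i.*2).+1)) (s (inord (i.*2).+2)))); last first.
  by move=> i _; rewrite dalphaE// sn0//=; rewrite ltnS -?doubleS ?leq_double ?ltn_double.
rewrite big_split /= prodr_const card_ord.
have L (e b q P : R) : e * b * (q * P) = b * q * (e * P) by ring.
exact: L.
Qed.

(** Nonnegative terms cannot cancel and the identity permutation contributes 1, so the sum is
    positive without being evaluated. *)
Lemma contact_volume_neq0 : a != 0 -> r != 0 ->
  (forall s, 0 <= volume_sign s) -> contact_volume alpha x v != 0.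
Proof using alphaE dalphaE.
move=> a0 r0 vs0; rewrite contact_volumeE !mulf_neq0 ?expf_neq0//.
rewrite gt_eqF// (bigD1 1%g)//= ltr_pwDl//; last exact: sumr_ge0.
rewrite /volume_sign perm1 eqxx odd_perm1 expr0 !mul1r prodr_gt0// => i _.
have h1 : ((i.*2).+1 < (n.*2).+1)%N by rewrite ltnS ltn_double.
have h2 : ((i.*2).+2 < (n.*2).+1)%N by rewrite ltnS -doubleS leq_double.
rewrite !perm1 !inordK//.
rewrite /symplectic_pairing /= odd_double /= eqxx subr0.
by rewrite ltr01.
Qed.

End Volume.

Lemma volume_sign1_ge0 (s : 'S_3) : 0 <= @volume_sign 1 s.
Proof.
rewrite /volume_sign big_ord1 /=; case: eqP => s0; last by rewrite !mul0r.
rewrite mul1r.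
have -> : inord 1 = @Ordinal 3 1 isT by apply: val_inj; rewrite /= inordK.
have -> : inord 2 = @Ordinal 3 2 isT by apply: val_inj; rewrite /= inordK.
have ext (t : 'S_3) : val (s ord0) = val (t ord0) ->
    val (s (@Ordinal 3 1 isT)) = val (t (@Ordinal 3 1 isT)) ->
    val (s (@Ordinal 3 2 isT)) = val (t (@Ordinal 3 2 isT)) -> s = t.
  move=> h0 h1 h2; apply/permP => -[[|[|[|//]]] hi]; apply: val_inj.
  - by rewrite (_ : Ordinal hi = ord0)//; exact: val_inj.
  - by rewrite (_ : Ordinal hi = @Ordinal 3 1 isT)//; exact: val_inj.
  - by rewrite (_ : Ordinal hi = @Ordinal 3 2 isT)//; exact: val_inj.
case E1 : (s (@Ordinal 3 1 isT)) => [k1 h1]; case E2 : (s (@Ordinal 3 2 isT)) => [k2 h2].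
rewrite /symplectic_pairing.
move: k1 k2 h1 h2 E1 E2 => [|[|[|//]]] [|[|[|//]]] h1 h2 E1 E2;
  rewrite /= ?subr0 ?sub0r ?mulr0 ?mulr1 ?mulrN1 ?lexx //.
- have -> : s = 1%g by apply: ext; rewrite ?E1 ?E2 perm1.
  by rewrite odd_perm1.
- have -> : s = tperm (@Ordinal 3 1 isT) (@Ordinal 3 2 isT).
    by apply: ext; rewrite ?E1 ?E2 permE.
  by rewrite odd_tperm expr1 opprK.
Qed.

(** A nonzero product forces the permutation to preserve the partition into {1, 2} and {3, 4}.
    Exchanging the two pairs is even, and a flip inside a pair changes the sign of both the
    permutation and the product. *)
Lemma volume_sign2_ge0 (s : 'S_5) : 0 <= @volume_sign 2 s.
Proof.
rewrite /volume_sign !big_ord_recl big_ord0 /= mulr1.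
case: eqP => s0; last by rewrite !mul0r.
rewrite mul1r.
set o1 := @Ordinal 5 1 isT; set o2 := @Ordinal 5 2 isT.
set o3 := @Ordinal 5 3 isT; set o4 := @Ordinal 5 4 isT.
have -> : inord 1 = o1 by apply: val_inj; rewrite /= inordK.
have -> : inord 2 = o2 by apply: val_inj; rewrite /= inordK.
have -> : inord 3 = o3 by apply: val_inj; rewrite /= inordK.
have -> : inord 4 = o4 by apply: val_inj; rewrite /= inordK.
have ext (t : 'S_5) : val (s ord0) = val (t ord0) -> val (s o1) = val (t o1) ->
    val (s o2) = val (t o2) -> val (s o3) = val (t o3) -> val (s o4) = val (t o4) -> s = t.
  move=> h0 h1 h2 h3 h4; apply/permP => -[[|[|[|[|[|//]]]]] hi]; apply: val_inj.
  - by rewrite (_ : Ordinal hi = ord0)//; exact: val_inj.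
  - by rewrite (_ : Ordinal hi = o1)//; exact: val_inj.
  - by rewrite (_ : Ordinal hi = o2)//; exact: val_inj.
  - by rewrite (_ : Ordinal hi = o3)//; exact: val_inj.
  - by rewrite (_ : Ordinal hi = o4)//; exact: val_inj.
(* These two inequalities already prevent both pairs from having the same image. *)
have inj13 : s o1 != s o3 by rewrite (inj_eq perm_inj).
have inj14 : s o1 != s o4 by rewrite (inj_eq perm_inj).
move: inj13 inj14.
case E1 : (s o1) => [k1 h1]; case E2 : (s o2) => [k2 h2].
case E3 : (s o3) => [k3 h3]; case E4 : (s o4) => [k4 h4].
rewrite /symplectic_pairing -!val_eqE.
(* The eight surviving permutations are products of the two flips [t12], [t34] and the exchange [t]
   of the pairs. *)
pose t12 := tperm o1 o2; pose t34 := tperm o3 o4; pose t := (tperm o1 o3 * tperm o2 o4)%g.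
move: k1 k2 h1 h2 E1 E2 => [|[|[|[|[|//]]]]] [|[|[|[|[|//]]]]] h1 h2 E1 E2;
  rewrite /= ?subr0 ?sub0r ?mul0r ?mulr0 ?lexx //;
  move: k3 k4 h3 h4 E3 E4 => [|[|[|[|[|//]]]]] [|[|[|[|[|//]]]]] h3 h4 E3 E4 //= _ _;
  rewrite ?subr0 ?sub0r ?mulr0 ?mulrN1 ?mulr1 ?opprK ?lexx //.
- have -> : s = 1%g by apply: ext; rewrite ?s0 ?E1 ?E2 ?E3 ?E4 perm1.
  by rewrite odd_perm1.
- have -> : s = t34 by apply: ext; rewrite ?s0 ?E1 ?E2 ?E3 ?E4 permE.
  by rewrite odd_tperm expr1 opprK.
- have -> : s = t12 by apply: ext; rewrite ?s0 ?E1 ?E2 ?E3 ?E4 permE.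
  by rewrite odd_tperm expr1 mulrNN mulr1.
- have -> : s = (t12 * t34)%g.
    by apply: ext; rewrite ?s0 ?E1 ?E2 ?E3 ?E4 permM !permE.
  by rewrite odd_permM !odd_tperm mulr1.
- have -> : s = t.
    by apply: ext; rewrite ?s0 ?E1 ?E2 ?E3 ?E4 permM !permE.
  by rewrite odd_permM !odd_tperm.
- have -> : s = (t34 * t)%g.
    by apply: ext; rewrite ?s0 ?E1 ?E2 ?E3 ?E4 !permM !permE.
  by rewrite !odd_permM !odd_tperm expr1 opprK.
- have -> : s = (t12 * t)%g.
    by apply: ext; rewrite ?s0 ?E1 ?E2 ?E3 ?E4 !permM !permE.
  by rewrite !odd_permM !odd_tperm expr1 mulrNN mulr1.
- have -> : s = (t12 * t34 * t)%g.
    by apply: ext; rewrite ?s0 ?E1 ?E2 ?E3 ?E4 !permM !permE.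
  by rewrite !odd_permM !odd_tperm mulr1.
Qed.

(** Fewer than n orthogonality conditions have a nonzero common solution: a kernel vector of the
    matrix with columns [v i], then normalized. *)
Lemma orthonormal_extension n k (v : 'I_k -> 'rV[R]_n) : (k < n)%N ->
  exists u : 'rV[R]_n, dot u u = 1 /\ forall i, dot (v i) u = 0.
Proof.
move=> kn; pose A := \matrix_(j < n, i < k) v i 0 j.
have /rowV0Pn[u uA u0] : kermx A != 0.
  by rewrite -mxrank_eq0 mxrank_ker -lt0n subn_gt0 (leq_ltn_trans (rank_leq_col A)).
have /sub_kermxP uA0 := uA.
have vu i : dot (v i) u = 0.
  move: uA0 => /rowP/(_ i); rewrite !mxE /dot => E; rewrite -[RHS]E.
  by apply: eq_bigr => j _; rewrite mxE mulrC.
exists ((enorm u)^-1 *: u); split=> [|i]; last by rewrite dotZr vu mulr0.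
by rewrite dotZl dotZr mulrA -expr2 -sqr_enorm -exprMn mulVf ?expr1n// gt_eqF// enorm_gt0.
Qed.

End ContactVolume.

(** * The contact condition on a radial graph *)

Section ContactGraph.
Context {R : realType}.

Lemma orthonormal_frame n (l0 : seq 'rV[R]_n) k : (size l0 + k <= n)%N ->
  exists b : nat -> 'rV[R]_n,
    (forall i j, (i < k)%N -> (j < k)%N -> dot (b i) (b j) = (i == j)%:R) /\
    (forall x i, x \in l0 -> (i < k)%N -> dot x (b i) = 0).
Proof.
elim: k => [|k IH] kn; first by exists (fun=> 0); split.
have [|b [bb lb]] := IH; first by rewrite (leq_trans _ kn)// leq_add2l.
pose l := l0 ++ mkseq b k.
have [|u [uu lu]] := @orthonormal_extension R n (size l) (fun i => nth 0 l i).
  by rewrite size_cat size_mkseq -addnS.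
have {}lu x : x \in l -> dot x u = 0.
  by rewrite -index_mem => xl; have := lu (Ordinal xl); rewrite /= nth_index// -index_mem.
have bu i : (i < k)%N -> dot (b i) u = 0.
  move=> ik; apply: lu; rewrite mem_cat; apply/orP; right.
  by apply/mapP; exists i => //; rewrite mem_iota.
exists (fun i => if i == k then u else b i); split=> [i j|x i xl0].
  move=> ik1 jk1; have lt i' : (i' < k.+1)%N -> i' != k -> (i' < k)%N by lia.
  case: (eqVneq i k) => [->|ik]; case: (eqVneq j k) => [jk|jk].
  - by rewrite uu.
  - by rewrite dotC bu ?lt.
  - by rewrite bu ?lt// jk (negbTE ik).
  - by rewrite bb ?lt.
move=> ik1; have [_|ik] := eqVneq i k; last by apply: lb => //; lia.
by apply: lu; rewrite mem_cat xl0.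
Qed.

Variable m : nat.
Let VV := ('rV[R]_m.+2 * 'rV[R]_m.+2)%type.
Let S : set VV := @unit_cotangent_sphere R m.+1.

(* At w = (xi, v), a geodesic velocity followed by symplectically dual pairs
   of a vertical and a horizontal vector. *)
Definition contact_frame (w : VV) (b : nat -> 'rV[R]_m.+2) (i : nat) : VV :=
  if i == 0%N then (w.2, - w.1)
  else if odd i then (0, b i.-1./2) else (b i.-1./2, 0).

Lemma contact_frame_index i : (i < (m.*2).+1)%N -> i != 0%N -> (i.-1./2 < m)%N.
Proof. by rewrite -divn2 -muln2; lia. Qed.

Lemma contact_frame_pair i j : odd i -> ~~ odd j -> j != 0%N ->
  (i.-1./2 == j.-1./2) = (j == i.+1).
Proof. by rewrite -!divn2; lia. Qed.

Lemma contact_frame_odd i j : odd i -> odd j -> (j == i.+1) = false.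
Proof. lia. Qed.

Lemma contact_frame_tangent w b i : S w ->
  (forall i j, (i < m)%N -> (j < m)%N -> dot (b i) (b j) = (i == j)%:R) ->
  (forall x i, x \in [:: w.1; w.2] -> (i < m)%N -> dot x (b i) = 0) ->
  (i < (m.*2).+1)%N -> tangent S w (contact_frame w b i).
Proof.
move=> /unit_cotangent_sphereP[w11 w12 w22] bb wb im.
have dE := (@dotDl R m.+2, @dotDr R m.+2, @dotZl R m.+2, @dotZr R m.+2,
  @dotNl R m.+2, @dotNr R m.+2, @dot0l R m.+2, @dot0r R m.+2, w11, w12, w22).
have w21 : dot w.2 w.1 = 0 by rewrite dotC.
rewrite /contact_frame; have [_|i0] := eqVneq i 0%N.
  (* Each frame vector is the velocity of a rotation inside [S]: here xi and eta turn together along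
     a geodesic; below, eta turns towards [b j], then xi does. *)
  apply: (tangent_rotation (A := (w.1, w.2))) => c s cs; apply/unit_cotangent_sphereP.
  rewrite /= !dE !w21.
  by split; [rewrite -[RHS]cs; ring|ring|rewrite -[RHS]cs; ring].
set j := i.-1./2; have jm : (j < m)%N.
  exact: contact_frame_index.
have w1b : dot w.1 (b j) = 0 by apply: wb => //; rewrite mem_head.
have w2b : dot w.2 (b j) = 0 by apply: wb => //; rewrite inE mem_head orbT.
have bbj : dot (b j) (b j) = 1 by rewrite bb// eqxx.
have dE2 := (dE, w21, w1b, w2b, bbj, dotC (b j) w.1, dotC (b j) w.2).
case: ifP => _.
  apply: (tangent_rotation (A := (0, w.2))) => c s cs; apply/unit_cotangent_sphereP.
  by rewrite /= !scaler0 !addr0 !dE2; split; [by []|ring|rewrite -[RHS]cs; ring].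
apply: (tangent_rotation (A := (w.1, 0))) => c s cs; apply/unit_cotangent_sphereP.
by rewrite /= !scaler0 !addr0 !dE2; split; [rewrite -[RHS]cs; ring|ring|].
Qed.

Variable rho : VV -> R^o.
Hypothesis srho : smooth_on S rho.
Hypothesis rho_gt0 : forall w, S w -> 0 < rho w.

Lemma contact_form_graph : (forall s, 0 <= @volume_sign R m s) ->
  contact_form m (fibre_scale rho @` S) (@lambda_can R m.+1).
Proof using srho rho_gt0.
move=> vs0; split; [exact: submanifold_graph|exact: one_form_lambda_can|].
move=> _ [w Sw <-]; have /unit_cotangent_sphereP[w11 w12 w22] := Sw.
have [//|b [bb wb]] := @orthonormal_frame m.+2 [:: w.1; w.2] m.
have /choice[k kP] : forall i : 'I_(m.*2).+1, exists k : R,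
    tangent (fibre_scale rho @` S) (fibre_scale rho w)
     ((contact_frame w b i).1, rho w *: (contact_frame w b i).2 + k *: w.2).
  move=> i; apply: graph_tangent => //; exact: contact_frame_tangent.
have r0 : rho w != 0 by rewrite gt_eqF// rho_gt0.
exists (fun i : 'I_(m.*2).+1 => ((contact_frame w b i).1,
  rho w *: (contact_frame w b i).2 + k i *: w.2)).
split => //.
have jm (i : 'I_(m.*2).+1) : i != 0 :> nat -> (i.-1./2 < m)%N.
  by apply: contact_frame_index; exact: ltn_ord.
have w2b (i : 'I_(m.*2).+1) : i != 0 :> nat -> dot w.2 (contact_frame w b i).1 = 0.
  move=> i0; rewrite /contact_frame (negbTE i0); case: ifP => _; first exact: dot0r.
  by apply: wb; [rewrite inE mem_head orbT|exact: jm].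
(* The form is [rho w] on the geodesic vector and 0 on the others. The radial corrections leave its
   exterior derivative unchanged on those others, whose horizontal parts are orthogonal to [w.2]. *)
apply: (contact_volume_neq0 (a := rho w) (r := rho w)) => //.
  move=> i; rewrite /lambda_can /= dotZl; case: eqVneq => [i0|i0].
    by rewrite /contact_frame i0 /= w22 mulr1.
  by rewrite w2b// mulr0.
move=> i j i0 j0; rewrite ext_deriv_lambda_can /= !dotDl !dotZl !w2b// !mulr0 !addr0 -mulrBr.
congr (_ * _); rewrite /contact_frame (negbTE i0) (negbTE j0) /symplectic_pairing.
case: ifP => oi; case: ifP => oj /=; rewrite ?dot0l ?dot0r ?subr0 ?sub0r.
- by rewrite (contact_frame_odd oi oj) (contact_frame_odd oj oi) subrr.
- by rewrite bb ?jm// contact_frame_pair ?oj.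
- by rewrite bb ?jm// contact_frame_pair ?oi.
- by [].
Qed.

End ContactGraph.

(** * Hill's region *)

Section HillScalar.
Context {R : realType}.
Variables (la1 la2 l : R).
Hypotheses (l_gt0 : 0 < l) (la2E : la2 = l ^+ 3) (la12 : la1 <= la2) (la2_ge1 : 1 <= la2).

(** The effective potential is U = -1/|q| - [hill_quad] / 2. *)
Definition hill_quad (x y z : R) : R := la2 * x ^+ 2 + la1 * y ^+ 2 - z ^+ 2.

Lemma hill_quad_le x y z N : N ^+ 2 = x ^+ 2 + y ^+ 2 + z ^+ 2 ->
  hill_quad x y z <= l ^+ 3 * N ^+ 2.
Proof using la2E la12 la2_ge1.
move=> NE; rewrite -la2E NE /hill_quad.
have := ler_wpM2r (sqr_ge0 y) la12; have := sqr_ge0 z.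
have : 0 <= (la2 - 1) * z ^+ 2 by rewrite mulr_ge0 ?sqr_ge0// subr_ge0.
by lra.
Qed.

(** On the sphere |q| = 1/l through L_1 and L_2, [hill_quad] is at most l^3 |q|^2 = l, so U >= -l -
    l/2, the critical value. *)
Lemma hill_barrier x y z N c : 0 < N -> N ^+ 2 = x ^+ 2 + y ^+ 2 + z ^+ 2 ->
  N * l = 1 -> c < - (3 / 2) * l -> c < - N^-1 - hill_quad x y z / 2.
Proof using l_gt0 la2E la12 la2_ge1.
move=> N0 /hill_quad_le A Nl cl.
have Nv : N^-1 = l by apply: (mulfI (lt0r_neq0 N0)); rewrite Nl mulfV ?gt_eqF.
have : l ^+ 3 * N ^+ 2 = l by rewrite (_ : _ * _ = l * (N * l) ^+ 2);
  [rewrite Nl expr1n mulr1|ring].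
by move=> E; rewrite E in A; rewrite Nv; lra.
Qed.

Lemma hill_quad_lt_inv x y z N : 0 < N -> N ^+ 2 = x ^+ 2 + y ^+ 2 + z ^+ 2 ->
  N * l < 1 -> hill_quad x y z < N^-1.
Proof using l_gt0 la2E la12 la2_ge1.
move=> N0 /hill_quad_le A Nl; apply: (le_lt_trans A).
rewrite -(ltr_pM2r N0) mulVf ?gt_eqF//.
rewrite (_ : _ * _ * N = (N * l) ^+ 3); last by ring.
by rewrite exprn_ilt1// mulr_ge0 ?ltW.
Qed.

(** Inside the ball [hill_quad] is below 1/|q|, so U(q) - U(t q) is at least (2/t - 3 + t^2) / (2
    N), and 2/t - 3 + t^2 = (1 - t)^2 (2/t + 1). *)
Lemma hill_radial x y z N t : 0 < N -> N ^+ 2 = x ^+ 2 + y ^+ 2 + z ^+ 2 ->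
  N * l < 1 -> 0 < t -> t <= 1 ->
  - (t * N)^-1 - hill_quad (t * x) (t * y) (t * z) / 2 <= - N^-1 - hill_quad x y z / 2.
Proof using l_gt0 la2E la12 la2_ge1.
move=> N0 NE Nl t0 t1; have := hill_quad_lt_inv N0 NE Nl.
rewrite (_ : hill_quad (t * x) _ _ = t ^+ 2 * hill_quad x y z); last first.
  by rewrite /hill_quad; ring.
move: (hill_quad x y z) => A AN; rewrite invfM.
have i1 : 1 <= t^-1 by rewrite invf_ge1.
have NV0 : 0 < N^-1 by rewrite invr_gt0.
have : (1 - t ^+ 2) * A <= (1 - t ^+ 2) * N^-1.
  by apply: ler_wpM2l; [rewrite subr_ge0 exprn_ile1// ltW|exact: ltW].
have : (1 - t) ^+ 2 * t^-1 * N^-1 >= 0.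
  by apply: mulr_ge0 (ltW NV0); apply: mulr_ge0; rewrite ?sqr_ge0 ?invr_ge0 ?(ltW t0).
have -> : (1 - t) ^+ 2 * t^-1 = t^-1 - 2 + t by field; rewrite gt_eqF.
have t2 : 0 <= (1 - t) * (1 - t) * N^-1 by rewrite !mulr_ge0 ?subr_ge0 ?(ltW NV0).
by move: (t^-1) i1 (N^-1) NV0 t2 => s s1 M M0; nra.
Qed.

(* The momentum pairing v1 y - v2 x is at most |v| N by Cauchy-Schwarz, with
   |v|^2 <= 2 (c - U); with t = l N the estimate reduces to
   l^3 (1 - t^3)^2 > t^3 (1 - t)^2 (t + 2). *)
Lemma hill_transversal x y z v1 v2 v3 N c : 0 < N ->
  N ^+ 2 = x ^+ 2 + y ^+ 2 + z ^+ 2 -> N * l < 1 -> c < - (3 / 2) * l ->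
  (v1 ^+ 2 + v2 ^+ 2 + v3 ^+ 2) / 2 - N^-1 - hill_quad x y z / 2 = c ->
  0 < v1 * y - v2 * x + N^-1 - hill_quad x y z.
Proof using l_gt0 la2E la12 la2_ge1.
move=> N0 NE Nl cl Hc.
have A1 := hill_quad_lt_inv N0 NE Nl.
have A2 := hill_quad_le NE.
move: (hill_quad x y z) A1 A2 Hc => A A1 A2 Hc.
rewrite ltNge; apply/negP => E.
(* Both use A <= l^3 N^2: [W0] bounds N^-1 - A from below and [T0], with c < -(3/2) l, bounds |v|^2
   from above. *)
pose W0 := N^-1 - l ^+ 3 * N ^+ 2.
pose T0 := 2 * N^-1 + l ^+ 3 * N ^+ 2 - 3 * l.
have NV0 : 0 < N^-1 by rewrite invr_gt0.
set t := N * l in Nl.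
have t0 : 0 < t by rewrite mulr_gt0.
have W0_gt0 : 0 < W0.
  rewrite /W0 subr_gt0 -(ltr_pM2r N0) mulVf ?gt_eqF//.
  rewrite (_ : _ * _ * N = t ^+ 3); last by rewrite /t; ring.
  by rewrite exprn_ilt1// ltW.
have WW : W0 ^+ 2 <= (v1 * y - v2 * x) ^+ 2.
  rewrite -[leRHS]sqrrN lerXn2r// ?nnegrE ?(ltW W0_gt0)//; rewrite /W0 in W0_gt0 *; lra.
have CS : (v1 * y - v2 * x) ^+ 2 <= (v1 ^+ 2 + v2 ^+ 2) * (x ^+ 2 + y ^+ 2).
  have := sqr_ge0 (v1 * x + v2 * y); nra.
have vT : v1 ^+ 2 + v2 ^+ 2 <= T0 by have := sqr_ge0 v3; rewrite /T0; lra.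
have T0_ge0 : 0 <= T0 by apply: le_trans vT; rewrite addr_ge0 ?sqr_ge0.
have key : W0 ^+ 2 <= T0 * N ^+ 2.
  apply: (le_trans WW); apply: (le_trans CS); apply: ler_pM => //.
  - by rewrite addr_ge0 ?sqr_ge0.
  - by rewrite addr_ge0 ?sqr_ge0.
  - by rewrite NE lerDl sqr_ge0.
(* The factor l^3 N^2 clears denominators and leaves only t = N l and one factor l^3 >= 1. *)
have : l ^+ 3 * (N * N) * (W0 ^+ 2) <= l ^+ 3 * (N * N) * (T0 * N ^+ 2).
  by rewrite ler_wpM2l// !mulr_ge0 ?exprn_ge0// ltW.
have -> : l ^+ 3 * (N * N) * (W0 ^+ 2) = l ^+ 3 * (1 - t ^+ 3) ^+ 2.
  by rewrite /W0 /t; field; rewrite gt_eqF.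
have -> : l ^+ 3 * (N * N) * (T0 * N ^+ 2) = t ^+ 3 * ((1 - t) ^+ 2 * (t + 2)).
  by rewrite /T0 /t; field; rewrite gt_eqF.
apply/negP; rewrite -ltNge.
have l31 : 1 <= l ^+ 3 by rewrite -la2E.
have : (1 - t ^+ 3) ^+ 2 <= l ^+ 3 * (1 - t ^+ 3) ^+ 2.
  by rewrite ler_peMl ?sqr_ge0.
apply: lt_le_trans; rewrite -subr_gt0.
(* After 1 - t^3 = (1 - t) (1 + t + t^2), the terms in t^3 and t^4 of (1 + t + t^2)^2 - t^3 (t + 2)
   cancel. *)
rewrite (_ : _ - _ = (1 - t) ^+ 2 * (1 + 2 * t + 3 * t ^+ 2)); last by ring.
by rewrite mulr_gt0 ?exprn_gt0 ?subr_gt0//; have := sqr_ge0 t; lra.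
Qed.

End HillScalar.

(** * The bounded component and its barrier sphere *)

Section HillRegion.
Context {R : realType}.
Variable mu : R.

Definition hill_ell : R := lambda2 mu `^ 3^-1.

Lemma hill_d_ge0 : 0 <= hill_d mu. Proof. exact: sqrtr_ge0. Qed.

Lemma lambda2_ge1 : 1 <= lambda2 mu.
Proof. by rewrite /lambda2; have := hill_d_ge0; lra. Qed.

Lemma lambda12 : lambda1 mu <= lambda2 mu.
Proof. by rewrite /lambda1 /lambda2; have := hill_d_ge0; lra. Qed.

Lemma hill_ell_gt0 : 0 < hill_ell.
Proof. by rewrite powR_gt0// (lt_le_trans ltr01 lambda2_ge1). Qed.

Lemma hill_ellE : lambda2 mu = hill_ell ^+ 3.
Proof.
have l0 := le_trans ler01 lambda2_ge1.
by rewrite -powR_mulrn ?powR_ge0// -powRrM mulVf ?pnatr_eq0// powRr1.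
Qed.

Lemma dot3 (q p : 'rV[R]_3) : dot q p = q 0 0 * p 0 0 + q 0 1 * p 0 1 + q 0 2 * p 0 2.
Proof.
rewrite /dot !big_ord_recl big_ord0 addr0 addrA.
by congr (_ + _ * _ + _ * _); congr (_ 0 _); apply: val_inj.
Qed.

Let quad := hill_quad (lambda1 mu) (lambda2 mu).

Definition hill_potential (q : 'rV[R]_3) : R :=
  - (enorm q)^-1 - quad (q 0 0) (q 0 1) (q 0 2) / 2.

Lemma enorm3 (q : 'rV[R]_3) : enorm q ^+ 2 = q 0 0 ^+ 2 + q 0 1 ^+ 2 + q 0 2 ^+ 2.
Proof. by rewrite sqr_enorm dot3. Qed.

Lemma hill_HE q p : hill_H mu (q, p) =
  ((p 0 0 + q 0 1) ^+ 2 + (p 0 1 - q 0 0) ^+ 2 + p 0 2 ^+ 2) / 2 + hill_potential q.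
Proof.
rewrite /hill_H /hill_potential /enorm dot3 -!expr2.
move: (Num.sqrt _)^-1 => N; rewrite /quad /hill_quad /hill_a /hill_b.
by field.
Qed.

Variable c : R.
Hypothesis cH : c < hill_H mu (crit_L1 mu).

Let cl : c < - (3 / 2) * hill_ell.
Proof. by rewrite -crit_L1_energy. Qed.

Lemma hill_regionP q : hill_region mu c q <-> q != 0 /\ hill_potential q <= c.
Proof.
split=> [[[q' p] [q0 E] <-]|[q0 Uc]].
  split=> //; rewrite -E hill_HE -[(q', p).1]/q' lerDr.
  by rewrite mulr_ge0// !addr_ge0 ?sqr_ge0.
(* The planar momentum makes the planar velocity vanish, and p_z carries the remaining energy. *)
exists (q, vec3 (- q 0 1) (q 0 0) (Num.sqrt (2 * (c - hill_potential q)))) => //.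
split => //; rewrite hill_HE /vec3 !mxE /= addNr subrr expr0n !add0r.
rewrite sqr_sqrtr; last by rewrite mulr_ge0// subr_ge0.
by rewrite mulrAC mulfV ?pnatr_eq0// mul1r subrK.
Qed.

Lemma hill_region_barrier q : hill_region mu c q -> enorm q * hill_ell != 1.
Proof using cH.
move=> /hill_regionP[q0 Uc]; apply/eqP => Nl.
have N0 : 0 < enorm q by rewrite enorm_gt0.
have := hill_barrier hill_ell_gt0 hill_ellE lambda12 lambda2_ge1 N0 (enorm3 q) Nl cl.
by rewrite ltNge Uc.
Qed.

Lemma continuous_enorm n : continuous (@enorm R n).
Proof.
have sd := smooth_open_dot openT (@smooth_open_idT R 'rV[R]_n) (@smooth_open_idT R _).
move=> q; apply: (@continuous_comp _ _ _ (fun q : 'rV[R]_n => dot q q : R) (@Num.sqrt R)).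
  exact: (smooth_open_continuous sd).
exact: sqrt_continuous.
Qed.

(** On a connected set |q| takes an interval of values, which avoids 1/l by
    [hill_region_barrier]. *)
Lemma connected_hill_region (C : set 'rV[R]_3) q q' : connected C ->
  C `<=` hill_region mu c -> C q -> C q' -> enorm q * hill_ell < 1 ->
  enorm q' * hill_ell < 1.
Proof using cH.
move=> cC CH Cq Cq' qi; rewrite ltNge; apply/negP => q'i.
have /connected_intervalP iI : connected (@enorm R 3 @` C).
  apply: connected_continuous_connected => //.
  by apply: continuous_subspaceT; exact: continuous_enorm.
have qI : (@enorm R 3 @` C) (enorm q) by exists q.
have q'I : (@enorm R 3 @` C) (enorm q') by exists q'.
have [|q1 Cq1 E] := iI _ _ qI q'I hill_ell^-1.
  rewrite -div1r ler_pdivlMr ?ler_pdivrMr ?hill_ell_gt0// q'i andbT ltW//.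
have := hill_region_barrier (CH _ Cq1).
by rewrite E mulVf ?eqxx// gt_eqF ?hill_ell_gt0.
Qed.

Lemma hill_region_ray q t : hill_region mu c q -> enorm q * hill_ell < 1 ->
  0 < t -> t <= 1 -> hill_region mu c (t *: q).
Proof.
move=> /hill_regionP[q0 Uc] qi t0 t1; apply/hill_regionP; split.
  by rewrite scaler_eq0 negb_or q0 gt_eqF.
apply: le_trans Uc; have N0 : 0 < enorm q by rewrite enorm_gt0.
rewrite /hill_potential enormZ gtr0_norm// !mxE.
exact: (hill_radial hill_ell_gt0 hill_ellE lambda12 lambda2_ge1 N0 (enorm3 q)).
Qed.

Lemma enorm_bound n (q : 'rV[R]_n) : `|q| <= enorm q.
Proof.
rewrite [leLHS]mx_normrE; apply: bigmax_le; first exact: enorm_ge0.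
move=> -[i j] _ /=; rewrite ord1 -(@ler_pXn2r _ 2%N)// ?nnegrE ?enorm_ge0//.
rewrite real_normK ?num_real// sqr_enorm /dot (bigD1 j)//= expr2 lerDl.
by apply: sumr_ge0 => k _; rewrite -expr2 sqr_ge0.
Qed.

(** A component cannot cross the barrier sphere, so one that accumulates at 0 stays inside;
    conversely, the ray from an inner point down to 0 stays in the region. *)
Lemma bounded_hill_regionP q : bounded_hill_region mu c q <->
  hill_region mu c q /\ enorm q * hill_ell < 1.
Proof using cH.
have l0 := hill_ell_gt0.
rewrite /bounded_hill_region /=; set C := connected_component _ q.
have cC : connected C by exact: component_connected.
have CH : C `<=` hill_region mu c by exact: connected_component_sub.
split=> [[Hq _ C0]|[Hq qi]].
  split => //; have Cq : C q by exact: connected_component_refl.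
  have oB : open_nbhs (0 : 'rV[R]_3) [set x | enorm x < hill_ell^-1].
    split; last by rewrite /= /enorm dot0l sqrtr0 invr_gt0.
    by apply: (@open_comp _ _ (@enorm R 3) [set x | x < hill_ell^-1]);
      [move=> x _; exact: continuous_enorm|exact: open_lt].
  have [q' [Cq' /= q'i]] := C0 _ (open_nbhs_nbhs oB).
  apply: (connected_hill_region cC CH Cq' Cq).
  by rewrite -ltr_pdivlMr// div1r.
have Cq : C q by exact: connected_component_refl.
have Cray t : 0 < t -> t <= 1 -> C (t *: q).
  move=> t0 t1; have sub : (fun s : R => s *: q) @` `]0, 1] `<=` C.
    apply: connected_component_max.
    - by exists 1; rewrite ?scale1r//= in_itv/= ltr01 lexx.
    - by move=> y [s /= ]; rewrite in_itv /= => /andP[s0 s1] <-; exact: hill_region_ray.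
    - apply: connected_continuous_connected; first apply/connected_intervalP.
        exact: interval_is_interval.
      by apply: continuous_subspaceT => s; exact: scalel_continuous.
  by apply: sub; exists t => //=; rewrite in_itv /= t0 t1.
split => //.
- exists hill_ell^-1; split; first by rewrite num_real.
  move=> M Ml x Cx /=; apply: (le_trans (enorm_bound x)); apply: (le_trans _ (ltW Ml)).
  by rewrite -[leRHS]div1r ler_pdivlMr// ltW// (connected_hill_region cC CH Cq Cx).
- move=> B nB; have : (fun s : R => s *: q) x @[x --> (0 : R)] --> (0 : 'rV[R]_3).
    by rewrite -[X in _ --> X](scale0r q); exact: scalel_continuous.
  move=> /(_ _ nB) /nbhs_ballP[e /= e0 eB].
  have m0 : 0 < Num.min e 1 by rewrite lt_min e0 ltr01.
  exists ((Num.min e 1 / 2) *: q); split.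
    apply: Cray; first by rewrite divr_gt0.
    by rewrite ler_pdivrMr// ge_min; apply/orP; right; lra.
  apply: eB; rewrite /ball /= sub0r normrN gtr0_norm ?divr_gt0//.
  by rewrite ltr_pdivrMr//; apply: (@le_lt_trans _ _ e); rewrite ?ge_min ?lexx//; lra.
Qed.

Lemma bounded_energy_setP q p : bounded_energy_set mu c (q, p) <->
  [/\ q != 0, enorm q * hill_ell < 1 & hill_H mu (q, p) = c].
Proof using cH.
split=> [[/bounded_hill_regionP[_ qi] [q0 E]]//|[q0 qi E]].
split => //; apply/bounded_hill_regionP; split => //.
by exists (q, p).
Qed.

Lemma hill_energy_barrier q p : q != 0 -> enorm q * hill_ell = 1 -> c < hill_H mu (q, p).
Proof using cH.
move=> q0 Nl; have N0 : 0 < enorm q by rewrite enorm_gt0.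
have := hill_barrier hill_ell_gt0 hill_ellE lambda12 lambda2_ge1 N0 (enorm3 q) Nl cl.
move=> /lt_le_trans; apply; rewrite hill_HE lerDr mulr_ge0// !addr_ge0 ?sqr_ge0//.
Qed.

(** The expression is q . dH/dq, the derivative of H along the ray of q at fixed p.
    [hill_transversal] is applied to the velocity (p_x + y, p_y - x, p_z). *)
Lemma hill_energy_transversal q p : q != 0 -> enorm q * hill_ell < 1 ->
  hill_H mu (q, p) = c ->
  0 < p 0 0 * q 0 1 - p 0 1 * q 0 0 + (enorm q)^-1 +
    2 * (hill_a mu * q 0 0 ^+ 2 + hill_b mu * q 0 1 ^+ 2 + q 0 2 ^+ 2 / 2).
Proof using cH.
move=> q0 Nl; have N0 : 0 < enorm q by rewrite enorm_gt0.
rewrite hill_HE /hill_potential addrA => E.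
have := hill_transversal hill_ell_gt0 hill_ellE lambda12 lambda2_ge1 N0 (enorm3 q) Nl cl E.
by congr (0 < _); rewrite /hill_quad /hill_a /hill_b; move: (enorm q)^-1 => M; field.
Qed.

End HillRegion.

(** * The regularized hypersurface as a graph *)

Section HillRoot.
Context {R : realType}.

(* If a cubic has positive derivative at two consecutive roots, then it has a
   third root between them, where the derivative is negative. *)
Lemma cubic_root_unique (a b g r s : R) : 0 < r -> 0 < s ->
  a * r + b * r ^+ 2 + g * r ^+ 3 = 1 -> a * s + b * s ^+ 2 + g * s ^+ 3 = 1 ->
  (forall t, 0 < t -> t <= Num.max r s -> a * t + b * t ^+ 2 + g * t ^+ 3 = 1 ->
     0 < a + 2 * b * t + 3 * g * t ^+ 2) -> r = s.
Proof.
wlog rs : r s / r < s.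
  move=> W r0 s0 Gr Gs D; have [rs|rs|//] := ltgtP r s; first exact: W.
  by apply/esym; apply: W => //; rewrite maxC.
move=> r0 s0 Gr Gs; rewrite (max_r (ltW rs)) => D; exfalso.
have sr0 : s - r != 0 by rewrite subr_eq0 gt_eqF.
(* The cubic minus 1 must be (t - r) (t - s) (g t - k), the constant term -1 forcing this [k]; the
   third root is k / g. *)
pose k := (r * s)^-1.
have rs0 : r * s != 0 by rewrite mulf_neq0 ?gt_eqF.
have K0 : a + b * (s + r) + g * (s * s + s * r + r ^+ 2) = 0.
  apply: (mulfI sr0); rewrite mulr0.
  transitivity ((a * s + b * s ^+ 2 + g * s ^+ 3) - (a * r + b * r ^+ 2 + g * r ^+ 3)).
    by ring.
  by rewrite Gr Gs subrr.
have bE : b = - k - g * (r + s).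
  apply: (mulfI rs0); rewrite mulrBr mulrN divff//.
  transitivity (- (a * r + b * r ^+ 2 + g * r ^+ 3) - (r * s) * (g * (r + s)) +
     r * (a + b * (s + r) + g * (s * s + s * r + r ^+ 2))); first by ring.
  by rewrite Gr K0 mulr0 addr0.
have aE : a = g * (r * s) + k * (r + s).
  transitivity ((a + b * (s + r) + g * (s * s + s * r + r ^+ 2)) +
    - b * (s + r) - g * (s * s + s * r + r ^+ 2)); first by ring.
  by rewrite K0 bE; ring.
have k0 : 0 < k by rewrite invr_gt0 mulr_gt0.
have kE : k * (r * s) = 1 by rewrite mulVf.
have Dt t : a + 2 * b * t + 3 * g * t ^+ 2 =
    (g * t - k) * (t - s) + (g * t - k) * (t - r) + g * ((t - r) * (t - s)).
  by rewrite aE bE; ring.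
have Dr := D r r0 (ltW rs) Gr; have Ds := D s s0 (lexx _) Gs.
rewrite Dt subrr mulr0 addr0 mul0r mulr0 addr0 in Dr.
rewrite Dt subrr mulr0 add0r mulr0 mulr0 addr0 in Ds.
have sr_gt0 : 0 < s - r by rewrite subr_gt0.
have gs : 0 < g * s - k by rewrite -(pmulr_lgt0 _ sr_gt0).
have gr : 0 < k - g * r.
  by rewrite -(pmulr_lgt0 _ sr_gt0) -mulrNN opprB opprB.
have g0 : 0 < g by rewrite -(pmulr_lgt0 _ sr_gt0); lra.
pose t := k / g.
have gt : g * t = k by rewrite mulrC divfK ?gt_eqF.
have tr : r < t by rewrite /t ltr_pdivlMr// mulrC; lra.
have ts : t < s by rewrite /t ltr_pdivrMr// mulrC; lra.
have := D t (lt_trans r0 tr) (ltW ts).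
rewrite Dt gt subrr !mul0r !add0r pmulr_rgt0//.
have Gt : a * t + b * t ^+ 2 + g * t ^+ 3 = 1.
  transitivity (1 + (t - r) * (t - s) * (g * t - k)).
    by rewrite aE bE -kE; ring.
  by rewrite gt subrr mulr0 addr0.
move=> /(_ Gt); apply/negP; rewrite -leNgt.
by apply: mulr_ge0_le0; rewrite ?subr_ge0 ?subr_le0 ltW.
Qed.

Variables (mu c : R).
Let VV := ('rV[R]_4 * 'rV[R]_4)%type.
Let S : set VV := @unit_cotangent_sphere R 3.
Let l : R := hill_ell mu.

(* The coefficients of the restriction of f to the ray through a unit covector. *)
Definition moser_al (w : VV) : R^o := 1 - (c + 2^-1) * (1 - w.1 0 0).
Definition moser_be (w : VV) : R^o := (1 - w.1 0 0) *
  (tail_row w.2 0 0 * tail_row w.1 0 1 - tail_row w.2 0 1 * tail_row w.1 0 0).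
Definition moser_ga (w : VV) : R^o := let g := (unstereo w).2 in (1 - w.1 0 0) *
  (hill_a mu * g 0 0 ^+ 2 + hill_b mu * g 0 1 ^+ 2 + g 0 2 ^+ 2 / 2).

Lemma smooth_moser_coefficients :
  [/\ smooth_open setT moser_al, smooth_open setT moser_be & smooth_open setT moser_ga].
Proof.
have s1 := smooth_open_fst openT (@smooth_open_idT R VV).
have s2 := smooth_open_snd openT (@smooth_open_idT R VV).
have scst (a : R^o) := smooth_open_cst (@openT VV) a.
have t1 := smooth_open_tail openT s1; have t2 := smooth_open_tail openT s2.
have x0 := smooth_open_coord openT 0 s1; have y0 := smooth_open_coord openT 0 s2.
have sk := smooth_openD openT (scst 1) (smooth_openN openT x0).
have sg : smooth_open setT (fun w : VV => (unstereo w).2).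
  by apply: (smooth_openD openT); exact: (smooth_openZ openT).
have sgi i := smooth_openX openT 2 (smooth_open_coord openT i sg).
have ti i j := smooth_openM openT (smooth_open_coord openT i t2) (smooth_open_coord openT j t1).
split.
- apply: (smooth_openD openT); first exact: scst.
  by apply: (smooth_openN openT); exact: (smooth_openM openT).
- apply: (smooth_openM openT) => //; apply: (smooth_openD openT); first exact: ti.
  by apply: (smooth_openN openT); exact: ti.
- apply: (smooth_openM openT) => //; apply: (smooth_openD openT).
    by apply: (smooth_openD openT); apply: (smooth_openM openT) => //; exact: sgi.
  by apply: (smooth_openM openT) => //; exact: sgi.
Qed.

Lemma unit_cotangent_head w : S w -> 0 <= 1 - w.1 0 0 <= 2.
Proof.
move=> /unit_cotangent_sphereP[w11 _ _].
have : w.1 0 0 ^+ 2 <= 1.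
  by rewrite -w11 /dot (bigD1 0)//= expr2 lerDl sumr_ge0// => i _; rewrite -expr2 sqr_ge0.
by nra.
Qed.

(** The conformal factor at xi is 1 - xi_0, which is therefore the norm of the position given by a
    unit covector; further along the ray, |q| = r (1 - xi_0). *)
Lemma moser_unstereo w : S w -> w.1 0 0 != 1 ->
  dot (unstereo w).1 (unstereo w).1 + 1 = 2 / (1 - w.1 0 0) /\
  enorm (unstereo w).2 = 1 - w.1 0 0.
Proof.
move=> Sw w1; have [wC _] := Sw; have /unit_cotangent_sphereP[_ _ w22] := Sw.
have k0 : 1 - w.1 0 0 != 0 by rewrite subr_eq0 eq_sym.
have /andP[k_ge0 _] := unit_cotangent_head Sw.
have wE := unstereoK wC w1.
have kE : 1 - w.1 0 0 = 2 / (dot (unstereo w).1 (unstereo w).1 + 1).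
  by rewrite -(stereo_head _ (unstereo w).2) -surjective_pairing wE.
have X0 : dot (unstereo w).1 (unstereo w).1 + 1 != 0 by rewrite gt_eqF// dotS_gt0.
split; first by rewrite kE invf_div mulrCA divff ?mulr1.
apply: (pexpIrn (n := 2)); rewrite ?nnegrE ?enorm_ge0// sqr_enorm.
have := stereo_dot2 (unstereo w).1 (unstereo w).2.
rewrite -surjective_pairing wE w22 kE.
move: (dot (unstereo w).1 _ + 1) X0 (dot (unstereo w).2 _) => s s0 p E.
by rewrite -[LHS]mul1r -[in LHS](divff (x := (s / 2) ^+ 2)) ?expf_neq0 ?mulf_neq0//;
  rewrite mulrAC -E; field.
Qed.

(** This is |eta| f = 1 + |q| (H - c). At a root H - c vanishes, so the slope in r is |q| dH/dr,
    that is (1 - xi_0) times the radial derivative q . dH/dq. *)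
Lemma moser_cubicE w r : S w -> w.1 0 0 != 1 -> 0 < r ->
  let q := r *: (unstereo w).2 in let p := - (unstereo w).1 in
  [/\ q != 0, enorm q = r * (1 - w.1 0 0),
    moser_al w * r + moser_be w * r ^+ 2 + moser_ga w * r ^+ 3 =
      1 + r * (1 - w.1 0 0) * (hill_H mu (q, p) - c) &
    moser_al w * r + moser_be w * r ^+ 2 + moser_ga w * r ^+ 3 = 1 ->
    moser_al w + 2 * moser_be w * r + 3 * moser_ga w * r ^+ 2 =
      (1 - w.1 0 0) * (p 0 0 * q 0 1 - p 0 1 * q 0 0 + (enorm q)^-1 +
        2 * (hill_a mu * q 0 0 ^+ 2 + hill_b mu * q 0 1 ^+ 2 + q 0 2 ^+ 2 / 2))].
Proof.
move=> Sw w1 r0 q p; have [XE gE] := moser_unstereo Sw w1.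
have k0 : 1 - w.1 0 0 != 0 by rewrite subr_eq0 eq_sym.
have /andP[k_ge0 _] := unit_cotangent_head Sw.
have qE : enorm q = r * (1 - w.1 0 0) by rewrite enormZ gtr0_norm// gE.
have rk0 : r * (1 - w.1 0 0) != 0 by rewrite mulf_neq0// gt_eqF.
have beE : moser_be w = (1 - w.1 0 0) *
    ((unstereo w).2 0 0 * (unstereo w).1 0 1 - (unstereo w).2 0 1 * (unstereo w).1 0 0).
  have X i : (unstereo w).1 0 i = (1 - w.1 0 0)^-1 * tail_row w.1 0 i.
    by rewrite [LHS]mxE.
  have g i : (unstereo w).2 0 i =
      (1 - w.1 0 0) * tail_row w.2 0 i + w.2 0 0 * tail_row w.1 0 i.
    by rewrite [LHS]mxE; congr (_ + _); rewrite [LHS]mxE.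
  rewrite /moser_be !X !g.
  by move: (1 - w.1 0 0) k0 (w.2 0 0) (tail_row w.1 0 0) (tail_row w.1 0 1) (tail_row w.2 0 0)
    (tail_row w.2 0 1) => k k0 z u0 u1 h0 h1; field.
have gaE : moser_ga w = (1 - w.1 0 0) * (hill_a mu * (unstereo w).2 0 0 ^+ 2 +
    hill_b mu * (unstereo w).2 0 1 ^+ 2 + (unstereo w).2 0 2 ^+ 2 / 2) by [].
have HE : hill_H mu (q, p) = (p 0 0 ^+ 2 + p 0 1 ^+ 2 + p 0 2 ^+ 2) / 2 +
    p 0 0 * q 0 1 - p 0 1 * q 0 0 - (Num.sqrt (q 0 0 ^+ 2 + q 0 1 ^+ 2 + q 0 2 ^+ 2))^-1 +
    hill_a mu * q 0 0 ^+ 2 + hill_b mu * q 0 1 ^+ 2 + q 0 2 ^+ 2 / 2 by [].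
have qi i : q 0 i = r * (unstereo w).2 0 i by rewrite [LHS]mxE.
have pi i : p 0 i = - (unstereo w).1 0 i by rewrite [LHS]mxE.
split => //.
- by rewrite -enorm_gt0 qE lt_def rk0 mulr_ge0// ltW.
- rewrite beE gaE HE /moser_al.
  have -> : Num.sqrt (q 0 0 ^+ 2 + q 0 1 ^+ 2 + q 0 2 ^+ 2) = enorm q.
    by rewrite /enorm dot3.
  rewrite qE !qi !pi; move: XE; rewrite dot3.
  move: (1 - w.1 0 0) k0 rk0 => k k0 rk0.
  move: ((unstereo w).1 0 0) ((unstereo w).1 0 1) ((unstereo w).1 0 2) => X0 X1 X2.
  move: ((unstereo w).2 0 0) ((unstereo w).2 0 1) ((unstereo w).2 0 2) => g0 g1 g2 XE.
  have sE : X0 * X0 + X1 * X1 + X2 * X2 = 2 / k - 1 by rewrite -XE addrK.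
  transitivity (1 + r * k * ((X0 * X0 + X1 * X1 + X2 * X2) / 2 + r * (g0 * X1 - g1 * X0)
    - (r * k)^-1 + hill_a mu * (r * g0) ^+ 2 + hill_b mu * (r * g1) ^+ 2
    + (r * g2) ^+ 2 / 2 - c)); last first.
    by congr (1 + _ * _); field; rewrite k0 gt_eqF.
  by rewrite sE; field; rewrite k0 gt_eqF.
- move=> root; rewrite qE !qi !pi.
  (* Eliminating the linear coefficient through the root equation turns the claim into a rational
     identity. *)
  have -> : moser_al w = r^-1 - moser_be w * r - moser_ga w * r ^+ 2.
    have L (A B C : R) : A * r + B * r ^+ 2 + C * r ^+ 3 = 1 ->
        A = r^-1 - B * r - C * r ^+ 2.
      move=> E; apply: (mulIf (lt0r_neq0 r0)).
      by rewrite !mulrBl mulVf ?gt_eqF// -[X in X - _ - _]E; ring.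
    exact: L.
  rewrite beE gaE; move: (1 - w.1 0 0) k0 => k k0.
  move: ((unstereo w).1 0 0) ((unstereo w).1 0 1) => X0 X1.
  move: ((unstereo w).2 0 0) ((unstereo w).2 0 1) ((unstereo w).2 0 2) => g0 g1 g2.
  by field; rewrite k0 gt_eqF.
Qed.

(** The middle condition is |q| < 1/l, which selects the bounded component; over the pole it holds
    automatically. *)
Definition moser_root (w : VV) (r : R) : Prop := [/\ 0 < r, r * (1 - w.1 0 0) * l < 1 &
  moser_al w * r + moser_be w * r ^+ 2 + moser_ga w * r ^+ 3 = 1].

Lemma moser_north (w : VV) : w.1 0 0 = 1 -> [/\ moser_al w = 1, moser_be w = 0 & moser_ga w = 0].
Proof.
by move=> w1; rewrite /moser_al /moser_be /moser_ga /= w1 subrr mulr0 subr0 !mul0r.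
Qed.

Hypothesis cH : c < hill_H mu (crit_L1 mu).

(** Over the pole the cubic is r itself, of slope 1; elsewhere the slope is a positive multiple of
    the radial derivative of H on the energy level. *)
Lemma moser_root_simple (w : VV) r : S w -> moser_root w r ->
  0 < moser_al w + 2 * moser_be w * r + 3 * moser_ga w * r ^+ 2.
Proof using cH.
move=> Sw [r0 rl G]; have [w1|w1] := eqVneq (w.1 0 0) 1.
  by have [-> -> ->] := moser_north w1; rewrite !mulr0 !mul0r !addr0.
have [q0 qE GE DE] := moser_cubicE Sw w1 r0; rewrite (DE G).
have k0 : 1 - w.1 0 0 != 0 by rewrite subr_eq0 eq_sym.
have /andP[k_ge0 _] := unit_cotangent_head Sw.
rewrite mulr_gt0//; first by rewrite lt_def k0.
apply: (hill_energy_transversal cH) => //; first by rewrite qE.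
move: G; rewrite GE => /eqP; rewrite -subr_eq0 addrAC subrr add0r mulf_eq0 subr_eq0.
by rewrite -qE gt_eqF ?enorm_gt0//= => /eqP.
Qed.

(** |q| does not decrease with r, so every positive root up to the larger of the two is admissible
    and has positive slope, as [cubic_root_unique] demands. *)
Lemma moser_root_unique w r s : S w -> moser_root w r -> moser_root w s -> r = s.
Proof using cH.
move=> Sw [r0 rl Gr] [s0 sl Gs]; apply: (cubic_root_unique r0 s0 Gr Gs) => t t0 tm Gt.
apply: moser_root_simple => //; split => //.
have /andP[k_ge0 _] := unit_cotangent_head Sw.
have l0 : 0 < l := hill_ell_gt0 mu.
apply: (@le_lt_trans _ _ (Num.max r s * (1 - w.1 0 0) * l)).
  by rewrite ler_wpM2r ?(ltW l0)// ler_wpM2r.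
by case: (leP r s).
Qed.

Lemma moser_root_exists w : S w -> exists r, moser_root w r.
Proof using cH.
move=> Sw; have [w1|w1] := eqVneq (w.1 0 0) 1.
  exists 1; have [a1 b1 g1] := moser_north w1.
  by split => //; rewrite ?w1 ?subrr ?mulr0 ?mul0r// a1 b1 g1 !mul0r !addr0 mulr1.
have k0 : 1 - w.1 0 0 != 0 by rewrite subr_eq0 eq_sym.
have /andP[k_ge0 _] := unit_cotangent_head Sw.
have k_gt0 : 0 < 1 - w.1 0 0 by rewrite lt_def k0.
have l0 : 0 < l := hill_ell_gt0 mu.
(* The ray hits the barrier sphere at [r1], where H > c puts the cubic above 1, while it is 0 at r =
   0. *)
pose r1 := ((1 - w.1 0 0) * l)^-1.
have r10 : 0 < r1 by rewrite invr_gt0 mulr_gt0.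
have r1E : r1 * (1 - w.1 0 0) * l = 1 by rewrite -mulrA mulVf// gt_eqF// mulr_gt0.
have [q0 qE GE _] := moser_cubicE Sw w1 r10.
have G1 : 1 < moser_al w * r1 + moser_be w * r1 ^+ 2 + moser_ga w * r1 ^+ 3.
  rewrite GE ltrDl mulr_gt0 ?(mulr_gt0 r10)// subr_gt0.
  by apply: (hill_energy_barrier cH) => //; rewrite qE.
have G0 : moser_al w * 0 + moser_be w * 0 ^+ 2 + moser_ga w * 0 ^+ 3 <= 1.
  by rewrite !expr0n !mulr0 !addr0.
have [r /andP[r_ge0 rr1] Gr] := cubic_IVT (ltW r10) G0 (ltW G1).
exists r; split => //.
  rewrite lt_def r_ge0 andbT; apply/eqP => r0.
  by move: Gr; rewrite r0 !expr0n !mulr0 !addr0 => /esym/eqP; rewrite oner_eq0.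
rewrite -[ltRHS]r1E !ltr_pM2r// lt_neqAle rr1 andbT; apply/eqP => E.
by move: G1; rewrite -E Gr ltxx.
Qed.

Definition moser_rho (w : VV) : R^o := xget 0 (moser_root w).

Lemma moser_rhoP w : S w -> moser_root w (moser_rho w).
Proof using cH.
move=> Sw; have [r rP] := moser_root_exists Sw.
by rewrite /moser_rho; case: xgetP => [s -> //|/(_ r)].
Qed.

Lemma moser_rho_gt0 w : S w -> 0 < moser_rho w.
Proof using cH. by move=> /moser_rhoP[]. Qed.

Lemma smooth_on_moser_rho : smooth_on S moser_rho.
Proof using cH.
move=> w Sw; have [sal sbe sga] := smooth_moser_coefficients.
have [r0 rl G] := moser_rhoP Sw; have l0 : 0 < l := hill_ell_gt0 mu.
(* The first bound keeps F positive; the second keeps F w inside the barrier, as 1 - xi_0 <= 2. The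
   barrier condition persists nearby, and there uniqueness identifies F with [moser_rho] on [S]. *)
pose e := Num.min (moser_rho w) ((1 - moser_rho w * (1 - w.1 0 0) * l) / (2 * l)).
have e0 : 0 < e by rewrite lt_min r0 divr_gt0 ?mulr_gt0// subr_gt0.
have [U' [F [oU' U'w _ sF FP]]] := cubic_implicit openT I e0 sal sbe sga G
  (moser_root_simple Sw (moser_rhoP Sw)).
have s1 := smooth_open_fst oU' (smooth_open_id oU').
have sh : smooth_open U' (fun y : VV => F y * (1 - y.1 0 0) * l : R^o).
  apply: (smooth_openM oU'); last exact: (smooth_open_cst oU').
  apply: (smooth_openM oU') => //; apply: (smooth_openD oU'); first exact: (smooth_open_cst oU').
  by apply: (smooth_openN oU'); exact: (smooth_open_coord oU').
have oU := open_preimage_on oU' (smooth_open_continuous sh) (@open_lt R 1).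
have U'P y : U' y -> 0 < F y.
  move=> /FP[Fe _]; have : e <= moser_rho w by rewrite ge_min lexx.
  by move: Fe; rewrite ltr_distl => /andP[]; lra.
exists (U' `&` (fun y : VV => F y * (1 - y.1 0 0) * l : R) @^-1` [set x | x < 1]), F.
split => //.
- split => //=; have [Fe _] := FP w U'w.
  have /andP[k_ge0 k_le2] := unit_cotangent_head Sw.
  have : e * (2 * l) <= 1 - moser_rho w * (1 - w.1 0 0) * l.
    by rewrite -ler_pdivlMr ?mulr_gt0// ge_min lexx orbT.
  move: Fe; rewrite ltr_distl => /andP[_ Fe].
  have := U'P w U'w.
  have [k_gt0|] := ltP 0 (1 - w.1 0 0); last first.
    by move=> k_le0; rewrite (_ : 1 - w.1 0 0 = 0) ?mulr0 ?mul0r//; lra.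
  move=> F0 E; apply: (lt_le_trans (y := (moser_rho w + e) * (1 - w.1 0 0) * l)).
    by rewrite !ltr_pM2r.
  have : e * (1 - w.1 0 0) * l <= e * 2 * l by rewrite !ler_pM2r// ler_pM2l.
  by lra.
- by apply: smooth_openW sF => y [].
- move=> y Sy [U'y /= Fl]; apply: (moser_root_unique Sy) (moser_rhoP Sy).
  by split => //; [exact: U'P|have [] := FP y U'y].
Qed.

End HillRoot.

(** * The closure of the image and its planar slice *)

Section Regularization.
Context {R : realType}.

Lemma unstereo_scale n (w : 'rV[R]_n.+1 * 'rV[R]_n.+1) a :
  unstereo (w.1, a *: w.2) = ((unstereo w).1, a *: (unstereo w).2).
Proof.
rewrite /unstereo /=; congr (_, _); apply/rowP => i; rewrite !mxE; ring.
Qed.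

Lemma dot_normalize n (u : 'rV[R]_n) : u != 0 ->
  dot ((enorm u)^-1 *: u) ((enorm u)^-1 *: u) = 1.
Proof.
move=> u0; rewrite dotZl dotZr mulrA -expr2 -sqr_enorm -exprMn mulVf ?expr1n//.
by rewrite gt_eqF// enorm_gt0.
Qed.

Variables mu c : R.
Hypothesis cH : c < hill_H mu (crit_L1 mu).
Let VV := ('rV[R]_4 * 'rV[R]_4)%type.
Let S : set VV := @unit_cotangent_sphere R 3.
Let rho : VV -> R^o := moser_rho mu c.
Let rho_gt0 w : S w -> 0 < rho w := moser_rho_gt0 cH (w := w).
Let srho : smooth_on S rho := smooth_on_moser_rho cH.

Lemma moser_image_graph : moser_Psi @` bounded_energy_set mu c =
  fibre_scale rho @` (S `&` [set w : VV | w.1 0 0 != 1]).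
Proof using cH.
apply/seteqP; split=> [x [[q p] /(bounded_energy_setP cH)[q0 ql E] <-]|x [w [Sw w1] <-]].
  rewrite -[moser_Psi (q, p)]/(stereo (- p, q)); set y := stereo (- p, q).
  have yC : cotangent_sphere y by exact: stereo_cotangent.
  have y1 : y.1 0 0 != 1 by exact: stereo_head_neq1.
  have y2 : y.2 != 0.
    rewrite -dot_eq0 stereo_dot2 mulf_neq0 ?dot_eq0// expf_neq0// mulf_neq0//.
    by rewrite gt_eqF// dotS_gt0.
  have r0 : 0 < enorm y.2 by rewrite enorm_gt0.
  pose w : VV := fibre_normalize y.
  have Sw : S w.
    have /cotangent_sphereP[y11 y12] := yC.
    apply/unit_cotangent_sphereP; split => //=; first by rewrite dotZr y12 mulr0.
    exact: dot_normalize.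
  have uw : unstereo w = (- p, (enorm y.2)^-1 *: q) by rewrite unstereo_scale stereoK.
  exists w => //.
  suff -> : fibre_scale rho w = (y.1, enorm y.2 *: ((enorm y.2)^-1 *: y.2)).
    by rewrite scalerA divff ?gt_eqF// scale1r -surjective_pairing.
  (* The norm of the covector is itself an admissible root on its ray. *)
  congr (_, _ *: _); apply: (moser_root_unique cH Sw (moser_rhoP cH Sw)).
  have [_] := moser_cubicE mu c Sw y1 r0.
  have -> : (unstereo w).1 = - p by rewrite uw.
  have -> : enorm y.2 *: (unstereo w).2 = q.
    by rewrite uw scalerA divff ?gt_eqF// scale1r.
  rewrite opprK => qE GE _.
  by split => //; [rewrite -qE|rewrite GE E subrr mulr0 addr0].
have [r0 rl G] := moser_rhoP cH Sw.
have [q0 qE GE _] := moser_cubicE mu c Sw w1 r0.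
exists (rho w *: (unstereo w).2, - (unstereo w).1).
  apply/(bounded_energy_setP cH); split => //; first by rewrite qE.
  move: G; rewrite GE => /eqP; rewrite -subr_eq0 addrAC subrr add0r mulf_eq0 subr_eq0.
  by rewrite -qE gt_eqF ?enorm_gt0//= => /eqP.
rewrite /moser_Psi /switch /= opprK.
transitivity (stereo (unstereo (fibre_scale rho w))); first by rewrite unstereo_scale.
apply: unstereoK => //; have /unit_cotangent_sphereP[w11 w12 _] := Sw.
by apply/cotangent_sphereP; rewrite /= dotZr w12 mulr0.
Qed.

Lemma unit_cotangent_rotate (w : VV) (a b : R) : S w -> a ^+ 2 + b ^+ 2 = 1 ->
  S (a *: w.1 + b *: w.2, a *: w.2 - b *: w.1).
Proof.
move=> /unit_cotangent_sphereP[w11 w12 w22] ab.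
have w21 : dot w.2 w.1 = 0 by rewrite dotC.
apply/unit_cotangent_sphereP.
rewrite /= !(@dotDl R 4, @dotDr R 4, @dotZl R 4, @dotZr R 4, @dotNl R 4, @dotNr R 4,
  w11, w12, w22, w21).
by split; [rewrite -[RHS]ab; ring|ring|rewrite -[RHS]ab; ring].
Qed.

Lemma regularized_graph : regularized mu c = fibre_scale rho @` S.
Proof using cH.
rewrite /regularized moser_image_graph; apply/seteqP; split.
  have cM : closed (fibre_scale rho @` S).
    apply: compact_closed; first exact: norm_hausdorff.
    exact: compact_graph srho.
  rewrite [X in _ `<=` X](closure_id _).1//.
  by apply: closureS => x [w [Sw _] <-]; exists w.
move=> x [w Sw <-]; have [w1|w1] := eqVneq (w.1 0 0) 1; last first.
  by apply: subset_closure; exists w.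
have /unit_cotangent_sphereP[w11 w12 w22] := Sw.
(* Covectors at the pole are orthogonal to it. *)
have w20 : w.2 0 0 = 0.
  have tw : tail_row w.1 = 0.
    apply/eqP; rewrite -dot_eq0; move: w11; rewrite -{1 2}(tail_rowK w.1) dot_cons w1 mulr1.
    by move=> /eqP; rewrite -subr_eq0 addrAC subrr add0r.
  have := dot_cons (w.1 0 0) (w.2 0 0) (tail_row w.1) (tail_row w.2).
  by rewrite !tail_rowK w12 w1 tw dot0l addr0 mul1r.
(* The geodesic starting at [w], with rational cosine and sine. Its height is (1 - t^2) / (1 + t^2),
   so it leaves the pole for t != 0, and the graph points over it converge to the one over [w]. *)
pose gam (t : R^o) : VV := let a := (1 - t ^+ 2) / (1 + t ^+ 2) : R in
  let b := 2 * t / (1 + t ^+ 2) : R in (a *: w.1 + b *: w.2, a *: w.2 - b *: w.1).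
have t0 (t : R) : 1 + t ^+ 2 != 0 by rewrite gt_eqF// ltr_pwDl// sqr_ge0.
have gamS t : S (gam t).
  by apply: unit_cotangent_rotate => //; field; exact: t0.
have gam0 : gam 0 = w.
  rewrite /gam expr0n /= mulr0 mul0r subr0 addr0 divr1 !scale1r !scale0r subr0 addr0.
  by case: (w).
have gam1 t : t != 0 -> (gam t).1 0 0 != 1.
  move=> tn0; rewrite !mxE w1 w20 mulr0 addr0 mulr1 -subr_eq0.
  rewrite (_ : _ - 1 = - 2 * t ^+ 2 / (1 + t ^+ 2)); last by field; exact: t0.
  by rewrite !mulf_neq0 ?invr_neq0 ?expf_neq0// oppr_eq0 pnatr_eq0.
have sgam : smooth_open setT gam.
  have scst (a : R^o) := smooth_open_cst (@openT R^o) a.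
  have sq := smooth_openX openT 2 (smooth_open_id (@openT R^o)).
  have sD := smooth_openD openT (scst 1) sq.
  have sV := smooth_openV openT (fun t _ => t0 t) sD.
  have sa := smooth_openM openT (smooth_openD openT (scst 1) (smooth_openN openT sq)) sV.
  have sb := smooth_openM openT (smooth_openM openT (scst 2) (smooth_open_id openT)) sV.
  have sc (u : 'rV[R]_4) := smooth_open_cst (@openT R^o) u.
  apply: (smooth_open_pair openT); apply: (smooth_openD openT).
  - exact: (smooth_openZ openT).
  - exact: (smooth_openZ openT).
  - exact: (smooth_openZ openT).
  - by apply: (smooth_openN openT); exact: (smooth_openZ openT).
have [U [G [oU Uw sG GS]]] := smooth_on_fibre_scale srho Sw.
have cG : (G \o gam) t @[t --> (0 : R^o)] --> fibre_scale rho w.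
  have -> : fibre_scale rho w = (G \o gam) 0 by rewrite /= gam0 GS.
  apply: (@continuous_comp _ _ _ gam G).
    exact: (smooth_open_continuous sgam).
  by rewrite gam0; exact: (smooth_open_continuous sG).
have cgam : gam t @[t --> (0 : R^o)] --> w.
  by rewrite -[X in _ --> X]gam0; exact: (smooth_open_continuous sgam).
move=> B nB; have nGB : nbhs (0 : R^o) (fun t => B (G (gam t))) by exact: (cG _ nB).
have nU : nbhs (0 : R^o) (fun t => U (gam t)).
  exact: (cgam _ (open_nbhs_nbhs (conj oU Uw))).
have [e /= e0 eB] := (@nbhs_ballP R R^o _ _).1 (filterI nGB nU).
have [GB Ugam] : B (G (gam (e / 2))) /\ U (gam (e / 2)).
  apply: eB; rewrite /ball /= sub0r normrN gtr0_norm ?divr_gt0// ltr_pdivrMr//; lra.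
exists (G (gam (e / 2))); split => //.
exists (gam (e / 2)); last by rewrite GS//; exact: gamS.
by split => //; apply: gam1; rewrite gt_eqF// divr_gt0.
Qed.

Lemma dot_row_mx m n (u v : 'rV[R]_m) (u' v' : 'rV[R]_n) :
  dot (row_mx u u') (row_mx v v') = dot u v + dot u' v'.
Proof.
rewrite /dot big_split_ord /=; congr (_ + _); apply: eq_bigr => i _.
  by rewrite !row_mxEl.
by rewrite !row_mxEr.
Qed.

Lemma dot_planar (u v : 'rV[R]_3) :
  dot (row_mx u (0 : 'rV_1) : 'rV_4) (row_mx v (0 : 'rV_1) : 'rV_4) = dot u v.
Proof. by apply: (etrans (dot_row_mx u v 0 0)); rewrite dot0l addr0. Qed.

Lemma scale_row_mx0 m n a (v : 'rV[R]_m) :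
  row_mx (a *: v) (0 : 'rV_n) = a *: row_mx v 0.
Proof. by rewrite scale_row_mx scaler0. Qed.

Lemma planar_unit_cotangent (w : 'rV[R]_3 * 'rV[R]_3) :
  S (planar_incl w) <-> @unit_cotangent_sphere R 2 w.
Proof.
split=> /unit_cotangent_sphereP[h1 h2 h3]; apply/unit_cotangent_sphereP.
  by rewrite -!dot_planar.
by rewrite !dot_planar.
Qed.

Lemma smooth_planar_incl : smooth_open setT (@planar_incl R).
Proof.
have s1 := smooth_open_fst openT (@smooth_open_idT R ('rV[R]_3 * 'rV[R]_3)%type).
have s2 := smooth_open_snd openT (@smooth_open_idT R ('rV[R]_3 * 'rV[R]_3)%type).
have srow (f : 'rV[R]_3 * 'rV[R]_3 -> 'rV[R]_3) : smooth_open setT f ->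
    smooth_open setT (fun w => row_mx (f w) (0 : 'rV_1) : 'rV[R]_4).
  move=> sf; apply: (smooth_open_row openT) => i.
  case E : (fintype.split (i : 'I_(3 + 1))) => [j|j].
    by apply: (smooth_open_ext openT _ (smooth_open_coord openT j sf)) => w _; rewrite mxE E.
  apply: (smooth_open_ext openT _ (smooth_open_cst openT (0 : R^o))) => w _.
  by rewrite mxE E mxE.
by apply: (smooth_open_pair openT); exact: srow.
Qed.

Let rho2 (w : 'rV[R]_3 * 'rV[R]_3) : R^o := rho (planar_incl w).

Lemma smooth_on_planar_rho : smooth_on (@unit_cotangent_sphere R 2) rho2.
Proof using cH.
apply: (smooth_on_comp (fin_dim_VV _) (B := S) (f := @planar_incl R)) srho.
  by move=> w /planar_unit_cotangent.
exact: (smooth_open_on openT) smooth_planar_incl.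
Qed.

Lemma planar_rho_gt0 w : @unit_cotangent_sphere R 2 w -> 0 < rho2 w.
Proof using cH. by move=> /planar_unit_cotangent; exact: rho_gt0. Qed.

(** Fibrewise scaling by a nonzero factor preserves the plane xi_3 = eta_3 = 0, so slicing the graph
    of [rho] gives the graph of its restriction, and the planar case inherits all estimates. *)
Lemma regularized_planar_graph :
  regularized_planar mu c = fibre_scale rho2 @` @unit_cotangent_sphere R 2.
Proof using cH.
rewrite /regularized_planar regularized_graph; apply/seteqP; split=> [[u v]|_ [w Sw <-]].
  move=> [[u' v'] Sw [E1 E2]]; rewrite /= in E1.
  have r0 := rho_gt0 Sw.
  have E : (u', v') = planar_incl (u, (rho (u', v'))^-1 *: v).
    congr (_, _); first exact: E1.
    rewrite -[LHS]scale1r -(mulVf (lt0r_neq0 r0)) -scalerA E2.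
    exact: (esym (@scale_row_mx0 3 1 _ v)).
  exists (u, (rho (u', v'))^-1 *: v); first by apply/planar_unit_cotangent; rewrite -E.
  by rewrite /fibre_scale /rho2 -E /= scalerA divff ?scale1r// gt_eqF.
exists (planar_incl w); first exact/planar_unit_cotangent.
by congr (_, _); exact: (esym (@scale_row_mx0 3 1 _ w.2)).
Qed.

End Regularization.

Theorem theorem1p1 (R : realType) (mu c : R) :
  0 <= mu <= 2^-1 ->
  c < hill_H mu (crit_L1 mu) ->
  [/\ compact (regularized mu c),
      regularized mu c `<=` @cotangent_sphere R 3,
      contact_form 2 (regularized mu c) (@lambda_can R 3)
    & contactomorphic (regularized mu c) (@lambda_can R 3)
        (@unit_cotangent_sphere R 3) (@lambda_can R 3)]
  /\
  [/\ compact (regularized_planar mu c),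
      regularized_planar mu c `<=` @cotangent_sphere R 2,
      contact_form 1 (regularized_planar mu c) (@lambda_can R 2)
    & contactomorphic (regularized_planar mu c) (@lambda_can R 2)
        (@unit_cotangent_sphere R 2) (@lambda_can R 2)].
Proof.
move=> _ cH; have srho := smooth_on_moser_rho cH; have rho0 := moser_rho_gt0 cH.
have srho2 := smooth_on_planar_rho cH; have rho20 := planar_rho_gt0 cH.
rewrite (regularized_planar_graph cH) (regularized_graph cH); split; split.
- exact: compact_graph.
- exact: graph_cotangent.
- by apply: contact_form_graph => //; exact: volume_sign2_ge0.
- exact: contactomorphic_graph.
- exact: compact_graph.
- exact: graph_cotangent.
- by apply: contact_form_graph => //; exact: volume_sign1_ge0.
- exact: contactomorphic_graph.
Qed.
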